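(* Let $(K,v)$ be a maximal field and let $(L|K,v)$ be an infinite algebraic extension of valued fields. Assume that $L|K$ contains an infinite separable subextension or that $$(vK:pvK)\,[Kv:(Kv)^p]\;<\;\infty,$$ where $p$ is the characteristic exponent of $Kv$. Then every maximal immediate extension of $(L,v)$ has infinite transcendence degree over $L$.
   Context: For a valued field $(K,v)$ (Krull valuation, written additively), $vK$ denotes the value group and $Kv$ the residue field. In a valued field extension $(L|K,v)$, $K$ carries the restriction of $v$ from $L$. The extension is immediate if the canonical embeddings $vK\hookrightarrow vL$ and $Kv\hookrightarrow Lv$ are onto. A valued field is maximal if it admits no proper immediate extension; a maximal immediate extension of $(L,v)$ is an immediate extension of $(L,v)$ which is a maximal field. The characteristic exponent of a field $k$ is $\mathrm{char}\,k$ if this is positive, and $1$ otherwise. $(Kv)^p$ denotes the field of $p$-th powers of elements of $Kv$.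
   Formalization: The valuation of K is assumed to be nontrivial; for the trivial valuation the claim fails (K = Q trivially valued is maximal, and its algebraic closure L is its own only maximal immediate extension, of transcendence degree 0). *)

(* Defs.v *)
From HB Require Import structures.
From mathcomp Require Import all_boot all_order all_algebra separable.
From mathcomp Require Import mpoly.

Set Implicit Arguments.
Unset Strict Implicit.
Unset Printing Implicit Defensive.

Import Order.TTheory GRing.Theory Num.Theory.
Local Open Scope ring_scope.
Local Open Scope quotient_scope.

HB.mixin Record isTotallyOrderedZmodule V of Num.POrderedZmodule V := {
  ozmod_total : total (<=%R : rel V);
  ozmod_lerD2l : forall z x y : V, x <= y -> z + x <= z + y
}.

#[short(type="orderedZmodType")]
HB.structure Definition OrderedZmodule :=
  {V of Num.POrderedZmodule V & isTotallyOrderedZmodule V}.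

HB.instance Definition _ (V : orderedZmodType) :=
  Order.POrder_isTotal.Build ring_display (OrderedZmodule.sort V)
    (@ozmod_total V).

(** A Krull valuation is given by its restriction to [K^*]: [valuation 0] is
    an unspecified junk value standing for [+oo], and no axiom mentions it.
    Since the valuation is onto, [value_group K] is exactly [vK]. *)
Record valuedField := ValuedField {
  vf_sort :> fieldType;
  value_group : orderedZmodType;
  valuation : vf_sort -> value_group;
  valuationM : forall x y : vf_sort, x != 0 -> y != 0 ->
    valuation (x * y) = valuation x + valuation y;
  valuationD : forall x y : vf_sort, x != 0 -> y != 0 -> x + y != 0 ->
    Order.min (valuation x) (valuation y) <= valuation (x + y);
  valuation_onto : forall g : value_group,
    exists2 x : vf_sort, x != 0 & valuation x = g
}.

Definition nontrivially_valued (K : valuedField) : Prop :=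
  exists2 x : K, x != 0 & valuation x != 0.

Section ResidueField.

Variable K : valuedField.
Implicit Types x y : K.
Local Notation v := (@valuation K).

Lemma ozmod_lerD (V : orderedZmodType) (a b c d : V) :
  a <= b -> c <= d -> a + c <= b + d.
Proof.
move=> ab cd; apply: (le_trans (ozmod_lerD2l a _ _ cd)).
by rewrite ![_ + d]addrC; apply: ozmod_lerD2l.
Qed.

Lemma ozmod_ltrD (V : orderedZmodType) (a b : V) :
  0 <= a -> 0 < b -> 0 < a + b.
Proof.
move=> a0 b0; apply: lt_le_trans b0 _.
by rewrite -[X in X <= _]add0r; apply: ozmod_lerD.
Qed.

Lemma valuation1 : v 1 = 0.
Proof.
have := @valuationM K 1 1 (oner_neq0 _) (oner_neq0 _).
by rewrite mulr1 => /eqP; rewrite -subr_eq0 opprD addNKr oppr_eq0 => /eqP.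
Qed.

Lemma valuationV x : x != 0 -> v x^-1 = - v x.
Proof.
move=> x0; apply/eqP; rewrite -addr_eq0 -valuationM ?invr_eq0 //.
by rewrite mulVf // valuation1.
Qed.

Lemma valuationN x : v (- x) = v x.
Proof.
have N1 : (-1 : K) != 0 by rewrite oppr_eq0 oner_neq0.
have vN1 : v (-1) = 0.
  have : v (-1) + v (-1) = 0 by rewrite -valuationM // mulrNN mulr1 valuation1.
  move=> h; case: (ltgtP (v (-1)) 0) => // c.
    have := ozmod_lerD (ltW c) (ltW c).
    have := ozmod_lerD2l (v (-1)) _ _ (ltW c).
    by rewrite h addr0 leNgt c.
  by have := ozmod_ltrD (ltW c) c; rewrite h ltxx.
have [->|x0] := eqVneq x 0; first by rewrite oppr0.
by rewrite -mulN1r valuationM // vN1 add0r.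
Qed.

Definition valuation_ring : {pred K} := fun x => (x == 0) || (0 <= v x).

Lemma valuation_ring_subring : subring_closed valuation_ring.
Proof.
split=> [|x y|x y]; rewrite !unfold_in /valuation_ring.
- by rewrite valuation1 lexx orbT.
- have [->|x0] /= := eqVneq x 0.
    by rewrite sub0r oppr_eq0 valuationN.
  have [->|y0] /= := eqVneq y 0; first by rewrite subr0 (negPf x0).
  move=> vx vy; have [//|xy0 /=] := eqVneq (x - y) 0.
  apply: le_trans (valuationD x0 _ xy0); last by rewrite oppr_eq0.
  by rewrite valuationN le_min vx.
- have [->|x0] /= := eqVneq x 0; first by rewrite mul0r eqxx.
  have [->|y0] /= := eqVneq y 0; first by rewrite mulr0 eqxx.
  move=> vx vy; rewrite valuationM //.
  by rewrite -[X in X <= _](addr0 0) ozmod_lerD ?orbT.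
Qed.

HB.instance Definition _ :=
  GRing.isSubringClosed.Build K valuation_ring valuation_ring_subring.

Record vring := VRing { vring_val :> K; _ : vring_val \in valuation_ring }.

HB.instance Definition _ := [isSub for vring_val].
HB.instance Definition _ := [Choice of vring by <:].
HB.instance Definition _ := [SubChoice_isSubComNzRing of vring by <:].

Lemma vring0 : vring_val 0 = 0. Proof. by []. Qed.
Lemma vring1 : vring_val 1 = 1. Proof. by []. Qed.
Lemma vringD (a b : vring) : vring_val (a + b) = vring_val a + vring_val b.
Proof. by []. Qed.
Lemma vringB (a b : vring) : vring_val (a - b) = vring_val a - vring_val b.
Proof. by []. Qed.
Lemma vringM (a b : vring) : vring_val (a * b) = vring_val a * vring_val b.
Proof. by []. Qed.

Definition maximal_ideal : {pred vring} :=
  fun x : vring => (vring_val x == 0) || (0 < v (vring_val x)).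

Lemma maximal_idealP : idealr_closed maximal_ideal.
Proof.
split=> [||a x y]; rewrite !unfold_in /maximal_ideal.
- by rewrite vring0 eqxx.
- by rewrite vring1 oner_eq0 valuation1 ltxx.
rewrite vringD vringM; move: a x y => [a aP] [x _] [y _] /=.
have [->|x0] /= := eqVneq x 0; first by rewrite mulr0 add0r.
move: aP; rewrite unfold_in /valuation_ring.
have [->|a0] /= := eqVneq a 0; first by rewrite mul0r add0r.
move=> va vx; have vax : 0 < v (a * x) by rewrite valuationM // ozmod_ltrD.
have [->|y0] /= := eqVneq y 0; first by rewrite addr0 vax orbT.
move=> vy; have [//|axy0 /=] := eqVneq (a * x + y) 0.
apply: lt_le_trans (valuationD _ y0 axy0); last by rewrite mulf_neq0.
by rewrite lt_min vax.
Qed.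

HB.instance Definition _ := isIdealr.Build vring maximal_ideal maximal_idealP.

Definition residue_field := {ideal_quot maximal_ideal}.
HB.instance Definition _ := GRing.ComNzRing.on residue_field.
HB.instance Definition _ := EqQuotient.on residue_field.

Definition residue (x : vring) : residue_field := \pi_residue_field x.

Lemma residue_eqE (x y : vring) :
  (residue x == residue y) = (x - y \in maximal_ideal).
Proof. by rewrite /residue -Quotient.idealrBE. Qed.

Lemma residue_is_zmod_morphism : zmod_morphism residue.
Proof. by move=> x y; rewrite /residue !piE. Qed.

Lemma residue_is_monoid_morphism : monoid_morphism residue.
Proof. by split=> [|x y]; rewrite /residue !piE. Qed.

HB.instance Definition _ :=
  GRing.isZmodMorphism.Build vring residue_field residue residue_is_zmod_morphism.
HB.instance Definition _ :=
  GRing.isMonoidMorphism.Build vring residue_field residue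
    residue_is_monoid_morphism.

(** [insubd] returns [0] when [x^-1] is not integral, so this is [0] at [0]. *)
Definition residue_inv (a : residue_field) : residue_field :=
  residue (insubd (0 : vring) (vring_val (repr a))^-1).

Lemma residue_eq0 (x : vring) : (residue x == 0) = (x \in maximal_ideal).
Proof. by rewrite -(raddf0 residue) residue_eqE subr0. Qed.

Lemma residue_mulVf (a : residue_field) : a != 0 -> residue_inv a * a = 1.
Proof.
have Ea : residue (repr a) = a by exact: reprK.
rewrite -{1 3}Ea residue_eq0 /residue_inv.
case: (repr a) => x xP /=; rewrite unfold_in /maximal_ideal /= negb_or.
case/andP=> x0; rewrite -leNgt => vx.
rewrite -(rmorphM residue) -(rmorph1 residue).
congr residue; apply: val_inj; change (val (insubd (0 : vring) x^-1) * x = 1 :> K).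
rewrite val_insubd.
move: xP; rewrite !unfold_in /valuation_ring (negPf x0) invr_eq0 (negPf x0) /=.
move=> vx'; have /eqP vx0 : v x == 0 by rewrite eq_le vx vx'.
by rewrite valuationV // vx0 oppr0 lexx mulVf.
Qed.

Lemma residue_inv0 : residue_inv 0 = 0.
Proof.
have : repr (0 : residue_field) \in maximal_ideal.
  by rewrite -residue_eq0 /residue reprK.
rewrite /residue_inv; case: (repr _) => x xP /=.
rewrite unfold_in /maximal_ideal /= => h.
rewrite -(raddf0 residue); congr residue; apply: val_inj.
change (val (insubd (0 : vring) x^-1) = 0 :> K).
rewrite val_insubd unfold_in /valuation_ring invr_eq0 /=.
change (val (0 : vring)) with (0 : K).
have [->|x0] /= := eqVneq x 0; first by rewrite invr0.
move: h; rewrite (negPf x0) /= valuationV // => vx.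
case: ifP => // nvx; have := ozmod_ltrD nvx vx.
by rewrite addNr ltxx.
Qed.

HB.instance Definition _ :=
  GRing.ComNzRing_isField.Build residue_field residue_mulVf residue_inv0.

End ResidueField.

(** [ext_value] is the embedding [vK -> vL]; it is determined by [ext_embed],
    and its existence as an order embedding says that the valuation of [K] is
    (up to this embedding) the restriction of that of [L]. *)
Record valuedExt (K L : valuedField) := ValuedExt {
  ext_embed : {rmorphism K -> L};
  ext_value : {additive value_group K -> value_group L};
  ext_value_mono : {mono ext_value : g h / g <= h};
  ext_compat : forall x : K, x != 0 ->
    valuation (ext_embed x) = ext_value (valuation x)
}.

Section Extensions.

Variables (K L : valuedField) (i : valuedExt K L).

Lemma ext_embed_vring (x : vring K) :
  ext_embed i (vring_val x) \in @valuation_ring L.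
Proof.
case: x => x xP /=; move: xP; rewrite !unfold_in /valuation_ring fmorph_eq0.
have [//|x0] /= := eqVneq x 0.
by rewrite ext_compat // -(raddf0 (ext_value i)) ext_value_mono.
Qed.

Definition ext_vring (x : vring K) : vring L := VRing (ext_embed_vring x).

Definition ext_residue (a : residue_field K) : residue_field L :=
  residue (ext_vring (repr a)).

(** [ext_residue] does not depend on the representative used to define it. *)
Lemma ext_residueE (x : vring K) :
  ext_residue (residue x) = residue (ext_vring x).
Proof.
apply/eqP; rewrite /ext_residue residue_eqE.
have : repr (residue x) - x \in @maximal_ideal K.
  by rewrite -residue_eqE /residue reprK.
rewrite !unfold_in /maximal_ideal !vringB /= -raddfB fmorph_eq0.
have [//|y0] /= := eqVneq (_ - _) 0.
by rewrite ext_compat // -(raddf0 (ext_value i)) !ltNge ext_value_mono.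
Qed.

Definition immediate : Prop :=
  (forall h : value_group L, exists g : value_group K, ext_value i g = h) /\
  (forall b : residue_field L, exists a : residue_field K, ext_residue a = b).

End Extensions.

Definition maximal_valued_field (K : valuedField) : Prop :=
  forall (L : valuedField) (i : valuedExt K L), immediate i ->
    forall y : L, exists x : K, ext_embed i x = y.

Definition maximal_immediate_ext (L M : valuedField) (j : valuedExt L M) :
    Prop :=
  immediate j /\ maximal_valued_field M.

(** [S] is meant to be a subfield; [s] spans [F] as an [S]-vector space. *)
Definition finite_degree_over (F : fieldType) (S : F -> Prop) : Prop :=
  exists s : seq F, forall x : F, exists c : 'I_(size s) -> F,
    (forall k, S (c k)) /\ x = \sum_k c k * s`_k.

Section FieldExtensions.

Variables (K L : fieldType) (f : {rmorphism K -> L}).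

Definition infinite_ext : Prop :=
  ~ finite_degree_over (fun y : L => exists x : K, f x = y).

Definition algebraic_ext : Prop := forall y : L, algebraicOver f y.

(** Up to a scalar, [q] below is the minimal polynomial of [y]. *)
Definition separable_ext : Prop :=
  forall y : L, exists q : {poly K},
    [/\ irreducible_poly q, root (map_poly f q) y & separable_poly q].

Definition algebraically_independent (n : nat) (b : 'I_n -> L) : Prop :=
  forall q : {mpoly K[n]}, mmap f b q = 0 -> q = 0.

(** The transcendence degree is the supremum of the sizes of the algebraically
    independent families. *)
Definition infinite_trdeg : Prop :=
  forall n : nat, exists b : 'I_n -> L, algebraically_independent b.

End FieldExtensions.

(** An intermediate field is presented as an abstract field [E] with a
    factorization of [f] through it. *)
Definition has_infinite_separable_subext (K L : fieldType)
    (f : {rmorphism K -> L}) : Prop :=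
  exists (E : fieldType) (g : {rmorphism K -> E}) (h : {rmorphism E -> L}),
    [/\ forall x : K, h (g x) = f x, separable_ext g & infinite_ext g].

Definition characteristic_exponent (k : fieldType) (p : nat) : Prop :=
  p \in [pchar k] \/ ([pchar k] =i pred0 /\ p = 1%N).

(** [s] contains representatives of all cosets of [pV] in [V]. *)
Definition finite_index_multiples (V : zmodType) (p : nat) : Prop :=
  exists s : seq V, forall g : V, exists2 r : V, r \in s
    & exists h : V, g - r = h *+ p.

Definition finite_p_degree (k : fieldType) (p : nat) : Prop :=
  finite_degree_over (fun y : k => exists x : k, x ^+ p = y).

(* Main.v *)
Require Import Defs.
From mathcomp Require Import all_boot all_order all_algebra.
From HB Require Import structures.
From mathcomp Require Import fraction qfpoly separable mpoly zify ring.
From Stdlib Require Import Classical ClassicalEpsilon.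

(** Fix [n].  Finite tuples of elements of [L] are chosen successively so that the
    [k]-th tuple [s_k] kills no nonzero polynomial over [K] of degree less than
    [k]; this is possible arbitrarily close to [s_(k-1)] because [L|K] contains
    elements [t] of arbitrarily large degree, and the powers [t, t^d, t^(d^2), ...]
    satisfy no relation of low degree.  As [K] is maximal, it is spherically
    complete (Kaplansky), so any two norms on a finite-dimensional [K]-space are
    comparable: [|P(s_k)| >= c_k |P|] for all such polynomials [P], with
    [|P|] the Gauss norm.  Choosing the later tuples closer to [s_k] than [c_k],
    a pseudo-limit [b] of the sequence in the maximal field [M] satisfies
    [P(b) <> 0] for every [P <> 0] over [K]: this is Liouville's argument.
    Algebraic independence over [K] then passes to the algebraic extension [L].

    Unbounded degrees come from the primitive element theorem if [L|K] has an
    infinite separable subextension.  Otherwise [K] has characteristic [p], and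
    the second hypothesis makes [K] finite over [K^p], since valuation-independent
    families over [K^p] have bounded length and a maximal one spans [K].  If
    degrees were bounded, some power [L^(p^e)] would lie in a simple extension of
    [K], hence in a finite-dimensional [K^(p^e)]-space, and [L|K] would be
    finite. *)

Set Implicit Arguments.
Unset Strict Implicit.
Unset Printing Implicit Defensive.

Import Order.TTheory GRing.Theory Num.Theory.
Local Open Scope ring_scope.

(** * The norm of a valued field *)

Lemma functional_choice (A B : Type) (P : A -> B -> Prop) :
  (forall a, exists b, P a b) -> exists g : A -> B, forall a, P a (g a).
Proof.
move=> h; exists (fun a => sval (constructive_indefinite_description _ (h a))).
by move=> a; case: (constructive_indefinite_description _ (h a)).
Qed.

Section OrderedZmodule.

Variable V : orderedZmodType.
Implicit Types x y z : V.

Lemma ozmod_leD2l z x y : (z + x <= z + y) = (x <= y).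
Proof.
apply/idP/idP; last exact: ozmod_lerD2l.
by move/(ozmod_lerD2l (- z)); rewrite !addKr.
Qed.

Lemma ozmod_leD2r z x y : (x + z <= y + z) = (x <= y).
Proof. by rewrite ![_ + z]addrC ozmod_leD2l. Qed.

Lemma ozmod_ltD2l z x y : (z + x < z + y) = (x < y).
Proof. by rewrite !ltNge ozmod_leD2l. Qed.

Lemma ozmod_ltD x y z t : x <= y -> z < t -> x + z < y + t.
Proof.
move=> xy zt; apply: (@lt_le_trans _ _ (x + t)); first by rewrite ozmod_ltD2l.
by rewrite ozmod_leD2r.
Qed.

Lemma ozmod_leMn2r n x y : x <= y -> x *+ n <= y *+ n.
Proof.
by move=> xy; elim: n => [|n IH]; rewrite ?mulr0n // !mulrS; apply: ozmod_lerD.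
Qed.

Lemma ozmod_ltMn2r n x y : (0 < n)%N -> x < y -> x *+ n < y *+ n.
Proof.
case: n => // n _ xy; rewrite !mulrSr; apply: ozmod_ltD => //.
exact/ozmod_leMn2r/ltW.
Qed.

End OrderedZmodule.

Section Norm.

Variable K : valuedField.
Implicit Types a b c d x y : K.
Local Notation v := (@valuation K).

(** [nle a b] reads [|a| <= |b|] for the multiplicative norm attached to [v],
    with [|0|] the least element. *)
Definition nle a b := (a == 0) || ((b != 0) && (v b <= v a)).
Definition nlt a b := ~~ nle b a.

Lemma nle_refl a : nle a a.
Proof. by rewrite /nle lexx andbT orbN. Qed.

Lemma nle_trans b a c : nle a b -> nle b c -> nle a c.
Proof.
rewrite /nle; have [//|a0 /=] := eqVneq a 0; case/andP=> b0 ab.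
by rewrite (negPf b0) /= => /andP[-> /le_trans]; apply.
Qed.

Lemma nle_total a b : nle a b || nle b a.
Proof.
rewrite /nle; have [//|a0 /=] := eqVneq a 0.
by have [//|b0 /=] := eqVneq b 0; rewrite ?orbT // le_total.
Qed.

Lemma nle0 a : nle 0 a. Proof. by rewrite /nle eqxx. Qed.

Lemma nlex0 a : nle a 0 = (a == 0).
Proof. by rewrite /nle eqxx orbF. Qed.

Lemma nleE a b : a != 0 -> b != 0 -> nle a b = (v b <= v a).
Proof. by rewrite /nle => /negPf -> ->. Qed.

Lemma nltE a b : a != 0 -> b != 0 -> nlt a b = (v b < v a).
Proof. by move=> a0 b0; rewrite /nlt nleE // ltNge. Qed.

Lemma nltW a b : nlt a b -> nle a b.
Proof. by rewrite /nlt; case/orP: (nle_total a b) => ->. Qed.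

Lemma nlt_neq0 a b : nlt a b -> b != 0.
Proof. by apply: contraNneq => ->; apply: nle0. Qed.

Lemma nlt0 a : nlt 0 a = (a != 0).
Proof. by rewrite /nlt nlex0. Qed.

Lemma nle_lt_trans b a c : nle a b -> nlt b c -> nlt a c.
Proof. by move=> ab; apply: contra => /nle_trans; apply. Qed.

Lemma nlt_le_trans b a c : nlt a b -> nle b c -> nlt a c.
Proof. by move=> ab bc; apply: contra ab; apply: nle_trans. Qed.

Lemma nltxx a : nlt a a = false.
Proof. by rewrite /nlt nle_refl. Qed.

Lemma nleN a b : nle (- a) b = nle a b.
Proof. by rewrite /nle oppr_eq0 valuationN. Qed.

Lemma nleNr a b : nle a (- b) = nle a b.
Proof. by rewrite /nle oppr_eq0 valuationN. Qed.

Lemma nleBC a b c : nle (a - b) c = nle (b - a) c.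
Proof. by rewrite -nleN opprB. Qed.

Lemma nleBCr a b c : nle c (a - b) = nle c (b - a).
Proof. by rewrite -nleNr opprB. Qed.

Lemma nleD a b c : nle a c -> nle b c -> nle (a + b) c.
Proof.
rewrite /nle; have [->|a0 /=] := eqVneq a 0; first by rewrite add0r.
have [->|b0 /=] := eqVneq b 0; first by rewrite addr0 (negPf a0).
case/andP=> c0 ca /andP[_ cb]; rewrite c0 /=.
have [//|ab0 /=] := eqVneq (a + b) 0.
by apply: le_trans (valuationD a0 b0 ab0); rewrite le_min ca.
Qed.

Lemma nleB a b c : nle a c -> nle b c -> nle (a - b) c.
Proof. by move=> ac bc; apply: nleD; rewrite ?nleN. Qed.

Lemma nltD a b c : nlt a c -> nlt b c -> nlt (a + b) c.
Proof.
move=> ac bc; case/orP: (nle_total a b) => ab.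
  by apply: nle_lt_trans bc; apply: nleD (nle_refl b).
by apply: nle_lt_trans ac; apply: nleD (nle_refl a) _.
Qed.

Lemma nle_addr a b : nlt b a -> nle a (a + b).
Proof.
move=> ba; apply/negPn/negP=> aab.
suff: nlt (a + b - b) a by rewrite addrK nltxx.
by apply: nltD => //; rewrite /nlt nleNr.
Qed.

Lemma nle_sum (I : Type) (r : seq I) (P : pred I) (F : I -> K) c :
  (forall i, P i -> nle (F i) c) -> nle (\sum_(i <- r | P i) F i) c.
Proof.
by move=> h; elim/big_ind: _ => // [|x y]; [exact: nle0 | exact: nleD].
Qed.

Lemma nlt_sum (I : Type) (r : seq I) (P : pred I) (F : I -> K) c : c != 0 ->
  (forall i, P i -> nlt (F i) c) -> nlt (\sum_(i <- r | P i) F i) c.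
Proof.
by move=> c0 h; elim/big_ind: _ => // [|x y]; rewrite ?nlt0 //; exact: nltD.
Qed.

Lemma nleM2l c a b : c != 0 -> nle (c * a) (c * b) = nle a b.
Proof.
move=> c0; rewrite /nle !mulf_eq0 (negPf c0) /=.
have [//|a0] := eqVneq a 0; have [//|b0 /=] := eqVneq b 0.
by rewrite !valuationM // ozmod_leD2l.
Qed.

Lemma nleM2r c a b : c != 0 -> nle (a * c) (b * c) = nle a b.
Proof. by rewrite ![_ * c]mulrC; apply: nleM2l. Qed.

Lemma nltM2l c a b : c != 0 -> nlt (c * a) (c * b) = nlt a b.
Proof. by rewrite /nlt => /nleM2l ->. Qed.

Lemma nleM a b c d : nle a b -> nle c d -> nle (a * c) (b * d).
Proof.
move=> ab cd; have [->|c0] := eqVneq c 0; first by rewrite mulr0 nle0.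
apply: (@nle_trans (b * c)); first by rewrite nleM2r.
have [->|b0] := eqVneq b 0; first by rewrite !mul0r nle0.
by rewrite nleM2l.
Qed.

Lemma nleX n a b : nle a b -> nle (a ^+ n) (b ^+ n).
Proof.
by move=> ab; elim: n => [|n IH]; rewrite ?nle_refl // !exprS; apply: nleM.
Qed.

Lemma nltX n a b : nlt a b -> nlt (a ^+ n.+1) (b ^+ n.+1).
Proof.
move=> ab; have b0 := nlt_neq0 ab; elim: n => [|n IH]; first by rewrite !expr1.
rewrite ![_ ^+ n.+2]exprS; apply: (@nle_lt_trans (b * a ^+ n.+1)).
  by apply: nleM (nle_refl _); apply: nltW.
by rewrite nltM2l.
Qed.

Lemma nleXE n a b : nle (a ^+ n.+1) (b ^+ n.+1) = nle a b.
Proof.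
by apply/idP/idP; [apply: contraTT; apply: nltX | apply: nleX].
Qed.

(** Isosceles principle: were [b] smaller than [a], then [a = (a - b) + b] would be smaller than
    itself. *)
Lemma nlt_approx a b : nlt (a - b) a -> nle a b && nle b a.
Proof.
move=> h; apply/andP; split.
  apply/negPn/negP=> ba; suff: nlt (a - b + b) a by rewrite subrK nltxx.
  exact: nltD.
by rewrite -[b](subKr a) nleB // ?nle_refl // nltW.
Qed.

(** After multiplication by [b * d] the error is [(a - c) * d - c * (b - d)]. Both terms are smaller
    than [a * d], because [c] has the norm of [a] and [d] that of [b]. *)
Lemma nlt_div_approx a b c d : nlt (a - c) a -> nlt (b - d) b ->
  nlt (a / b - c / d) (a / b).
Proof.
move=> ac bd; have [a0 b0] := (nlt_neq0 ac, nlt_neq0 bd).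
have [/andP[lac lca] /andP[lbd ldb]] := (nlt_approx ac, nlt_approx bd).
have d0 : d != 0 by apply: contraNneq b0 => d0; rewrite -nlex0 -d0.
rewrite -(nltM2l _ _ (mulf_neq0 b0 d0)).
have -> : b * d * (a / b) = a * d by field.
have -> : b * d * (a / b - c / d) = (a - c) * d - c * (b - d).
  by field; rewrite b0 d0.
have ad0 := mulf_neq0 a0 d0.
rewrite nltD //; first by rewrite ![_ * d]mulrC nltM2l.
rewrite /nlt nleNr; apply: (@nle_lt_trans (a * (b - d))) (_ : nlt (a * (b - d)) (a * d)).
  exact: nleM (nle_refl _).
by rewrite nltM2l //; apply: nlt_le_trans lbd.
Qed.

Lemma valuationB_neq a b : a != 0 -> b != 0 -> v a != v b ->
  a - b != 0 /\ v (a - b) = Order.min (v a) (v b).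
Proof.
move=> a0 b0 ab; have ab0 : a - b != 0 by apply: contraNneq ab => /subr0_eq ->.
split=> //; wlog ltab : a b a0 b0 ab ab0 / v a < v b.
  move=> wl; case: (ltgtP (v a) (v b)) => h; last by rewrite h eqxx in ab.
    by rewrite wl // min_l // ltW.
  rewrite -valuationN opprB wl //; first by rewrite min_l // ltW.
    by rewrite eq_sym.
  by rewrite -oppr_eq0 opprB.
have lt : nlt (a - (a - b)) a by rewrite subKr nltE.
have /andP[l1 l2] := nlt_approx lt; rewrite !nleE // in l1 l2.
by rewrite min_l ?ltW //; apply/eqP; rewrite eq_le l1 l2.
Qed.

Lemma valuationX n a : a != 0 -> v (a ^+ n) = v a *+ n.
Proof.
move=> a0; elim: n => [|n IH]; first by rewrite valuation1.
by rewrite exprS valuationM ?expf_neq0 // IH mulrS.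
Qed.

End Norm.

Section NormExtension.

Variables (K L : valuedField) (i : valuedExt K L).

Lemma nle_ext (a b : K) : nle (ext_embed i a) (ext_embed i b) = nle a b.
Proof.
rewrite /nle !fmorph_eq0; have [//|a0 /=] := eqVneq a 0.
by have [//|b0 /=] := eqVneq b 0; rewrite !ext_compat // ext_value_mono.
Qed.

End NormExtension.

(** * Immediate extensions from valued domains *)

Section DomainExtension.

Local Open Scope quotient_scope.

Variables (K : valuedField) (R : idomainType) (iota : {rmorphism K -> R}).
Variable w : R -> value_group K.
Hypothesis wM : forall x y : R, x != 0 -> y != 0 -> w (x * y) = w x + w y.
Hypothesis wD : forall x y : R, x != 0 -> y != 0 -> x + y != 0 ->
  Order.min (w x) (w y) <= w (x + y).
Hypothesis wiota : forall c : K, c != 0 -> w (iota c) = valuation c.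
(** This makes the extension to the fraction field immediate. The premise [x != iota c] guards
    against [w 0], which carries no meaning. *)
Hypothesis w_approx : forall x : R, x != 0 ->
  exists c : K, x != iota c -> w x < w (x - iota c).

Local Notation F := {fraction R}.
Local Notation "x %:F" := (tofrac x).

Definition frac_num (x : F) : R := \n_(repr x).
Definition frac_den (x : F) : R := \d_(repr x).

Lemma frac_den_neq0 x : frac_den x != 0.
Proof. exact: denom_ratioP. Qed.

Lemma fracE x : x = (frac_num x)%:F / (frac_den x)%:F.
Proof.
apply: (canRL (mulfK _)); first by rewrite tofrac_eq0 frac_den_neq0.
rewrite /frac_num /frac_den; move: (repr x) (reprK x) => [[n d] /= d0] <-.
unlock tofrac; rewrite -[LHS]FracField.pi_mul; apply/eqmodP.
rewrite /= /FracField.equivf /FracField.mulf /=.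
by rewrite !numden_Ratio ?oner_eq0 // ?mulr1 ?mulf_neq0 // mulrC.
Qed.

Lemma frac_num_neq0 x : x != 0 -> frac_num x != 0.
Proof.
by apply: contraNneq => x0; rewrite [x]fracE x0 tofrac0 mul0r.
Qed.

Definition frac_val (x : F) : value_group K := w (frac_num x) - w (frac_den x).

(** The choice made by [repr] does not matter: [wM] turns the cross-multiplied equality of two
    fractions into one of values. *)
Lemma frac_valE a b : a != 0 -> b != 0 -> frac_val (a%:F / b%:F) = w a - w b.
Proof.
move=> a0 b0; set x := _ / _; have x0 : x != 0.
  by rewrite mulf_neq0 ?invr_eq0 ?tofrac_eq0.
have d0 := frac_den_neq0 x; have n0 := frac_num_neq0 x0.
apply/eqP; rewrite subr_eq addrAC eq_sym subr_eq -!wM //.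
have : x = x by []; rewrite {1}/x {1}(fracE x) => /eqP.
by rewrite eqr_div ?tofrac_eq0 // -!tofracM tofrac_eq => /eqP->.
Qed.

Lemma frac_valM x y : x != 0 -> y != 0 ->
  frac_val (x * y) = frac_val x + frac_val y.
Proof.
move=> x0 y0; have nx0 := frac_num_neq0 x0; have ny0 := frac_num_neq0 y0.
have [dx0 dy0] := (frac_den_neq0 x, frac_den_neq0 y).
rewrite {1}(fracE x) {1}(fracE y) mulf_div -!tofracM.
by rewrite frac_valE ?mulf_neq0 // !wM // opprD addrACA.
Qed.

Lemma frac_valD x y : x != 0 -> y != 0 -> x + y != 0 ->
  Order.min (frac_val x) (frac_val y) <= frac_val (x + y).
Proof.
move=> x0 y0; have nx0 := frac_num_neq0 x0; have ny0 := frac_num_neq0 y0.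
have [dx0 dy0] := (frac_den_neq0 x, frac_den_neq0 y).
rewrite {1 3}(fracE x) {1 3}(fracE y) addf_div ?tofrac_eq0 // -!tofracM -tofracD.
move=> xy0; have n0 : frac_num x * frac_den y + frac_num y * frac_den x != 0.
  by apply: contraNneq xy0 => ->; rewrite tofrac0 mul0r.
rewrite frac_valE ?mulf_neq0 // -(ozmod_leD2r (w (frac_den x * frac_den y))).
rewrite subrK; apply: le_trans (wD _ _ n0); rewrite ?mulf_neq0 // !wM //.
rewrite le_min; set m := Order.min _ _; apply/andP; split.
  have : m <= frac_val x by rewrite ge_min lexx.
  rewrite -(ozmod_leD2r (w (frac_den x) + w (frac_den y))) => /le_trans; apply.
  by rewrite /frac_val addrA subrK.
have : m <= frac_val y by rewrite ge_min lexx orbT.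
rewrite -(ozmod_leD2r (w (frac_den x) + w (frac_den y))) => /le_trans; apply.
by rewrite /frac_val [w (frac_den x) + _]addrC addrA subrK.
Qed.

Lemma frac_val_iota c : c != 0 -> frac_val (iota c)%:F = valuation c.
Proof.
move=> c0; rewrite -[X in frac_val X]divr1 -tofrac1 frac_valE ?fmorph_eq0 ?oner_neq0 //.
by rewrite wiota // -(rmorph1 iota) wiota ?oner_neq0 // valuation1 subr0.
Qed.

Lemma frac_val_onto g : exists2 x : F, x != 0 & frac_val x = g.
Proof.
have [c c0 <-] := valuation_onto g; exists (iota c)%:F.
  by rewrite tofrac_eq0 fmorph_eq0.
exact: frac_val_iota.
Qed.

Definition frac_valued : valuedField :=
  ValuedField frac_valM frac_valD frac_val_onto.

Lemma frac_ext_mono : {mono (idfun : value_group K -> value_group frac_valued) :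
  g h / g <= h}.
Proof. by []. Qed.

Lemma frac_ext_compat c : c != 0 ->
  valuation ((@tofrac R \o iota) c : frac_valued) = idfun (valuation c).
Proof. exact: frac_val_iota. Qed.

Definition frac_ext : valuedExt K frac_valued :=
  @ValuedExt K frac_valued (@tofrac R \o iota) idfun frac_ext_mono frac_ext_compat.

Lemma nlt_domain_approx (a : R) : a != 0 ->
  exists c : K, nlt (a%:F - ext_embed frac_ext c : frac_valued) (a%:F : frac_valued).
Proof.
move=> a0; have [c hc] := w_approx a0; exists c => /=.
have [eac|nac] := eqVneq a (iota c).
  by rewrite -eac subrr nlt0 tofrac_eq0.
rewrite -[X in nlt X]tofracB nltE ?tofrac_eq0 ?subr_eq0 //.
have val_tofrac (z : R) : z != 0 -> frac_val z%:F = w z.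
  move=> z0; rewrite -[X in frac_val X]divr1 -tofrac1 frac_valE ?oner_neq0 //.
  by rewrite -(rmorph1 iota) wiota ?oner_neq0 // valuation1 subr0.
rewrite /valuation /= !val_tofrac ?subr_eq0 //; exact: hc.
Qed.

(** The value groups agree by construction. If numerator and denominator of an integral [y] are
    approximated in [K] by [c] and [d], then [c / d] differs from [y] by less than [|y| <= 1], so it
    has the residue of [y]. *)
Lemma frac_ext_immediate : immediate frac_ext.
Proof.
split=> [h|b]; first by exists h.
have -> : b = residue (repr b) by rewrite /residue reprK.
case: (repr b) => y yO; have := yO; rewrite unfold_in /valuation_ring.
have [y0 _|y0 /= vy] := eqVneq y 0.
  exists 0; rewrite -(rmorph0 (@residue K)) ext_residueE.
  by congr residue; apply: val_inj; rewrite /= y0 !rmorph0.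
have nd0 := frac_den_neq0 y; have nn0 := frac_num_neq0 y0.
have [c hc] := nlt_domain_approx nn0; have [d hd] := nlt_domain_approx nd0.
have := nlt_div_approx hc hd.
rewrite -(fracE y) -fmorph_div; set e := c / d => ye.
have y1 : nle y 1 by rewrite nleE ?oner_neq0 // valuation1.
have /andP[_ ley] := nlt_approx ye.
have e1 : nle e 1.
  by rewrite -(nle_ext frac_ext) rmorph1 (nle_trans ley).
have eO : e \in @valuation_ring K.
  by move: e1; rewrite unfold_in /valuation_ring /nle oner_neq0 valuation1.
exists (residue (VRing eO)); rewrite ext_residueE; apply/eqP.
rewrite eq_sym residue_eqE unfold_in /maximal_ideal vringB /=.
have [//|ye0] := eqVneq (y - _) 0.
by have := nlt_le_trans ye y1; rewrite nltE ?oner_neq0 // valuation1.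
Qed.

(** The source of all contradictions with maximality: a domain valued as above lies in an immediate
    extension of [K], its fraction field. *)
Lemma maximal_domain_onto : maximal_valued_field K ->
  forall x : R, exists c, iota c = x.
Proof.
move=> /(_ _ _ frac_ext_immediate) h x.
have [c /eqP] := h (x%:F); rewrite tofrac_eq => /eqP <-; by exists c.
Qed.

End DomainExtension.

(** * Kaplansky's theorem *)

(** Discs carry neither centre nor radius: a disc is a nonempty predicate that contains, with [x]
    and [y], every [z] at most as far from [x] as [y] is. *)
Definition spherically_complete (K : valuedField) : Prop :=
  forall (I : Type) (B : I -> K -> Prop),
    (forall i, exists x, B i x) ->
    (forall i j, (forall x, B i x -> B j x) \/ (forall x, B j x -> B i x)) ->
    (forall i x y z, B i x -> B i y -> nle (z - x) (x - y) -> B i z) ->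
  exists x, forall i, B i x.

Section EmptyChain.

Variables (K : valuedField) (I : Type) (B : I -> K -> Prop).
Hypothesis B_inhab : forall i, exists x, B i x.
Hypothesis B_chain : forall i j,
  (forall x, B i x -> B j x) \/ (forall x, B j x -> B i x).
Hypothesis B_disc : forall i x y z, B i x -> B i y -> nle (z - x) (x - y) -> B i z.
Hypothesis B_empty : forall x, exists i, ~ B i x.
Implicit Types (f g h q : {poly K}).

Lemma chain_nested i k y : B i y -> ~ B k y -> forall x, B k x -> B i x.
Proof. by move=> iy ky; case: (B_chain i k) => // /(_ y iy). Qed.

(** [P] holds from some disc on. The chain, having empty intersection, plays the role of a
    pseudo-Cauchy sequence without limit. *)
Definition ev (P : K -> Prop) := exists i, forall x, B i x -> P x.

Lemma ev_and (P Q : K -> Prop) : ev P -> ev Q -> ev (fun x => P x /\ Q x).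
Proof.
move=> [i iP] [j jQ]; case: (B_chain i j) => h; [exists i | exists j] => x Bx.
  by split; [apply: iP | apply/jQ/h].
by split; [apply/iP/h | apply: jQ].
Qed.

Lemma ev_mono (P Q : K -> Prop) : (forall x, P x -> Q x) -> ev P -> ev Q.
Proof. by move=> PQ [i iP]; exists i => x /iP/PQ. Qed.

Lemma ev_ex (P : K -> Prop) : ev P -> exists x, P x.
Proof. by move=> [i iP]; have [x /iP Px] := B_inhab i; exists x. Qed.

Lemma ev_all (P : K -> Prop) : (forall x, P x) -> ev P.
Proof. by move=> hP; have [i _] := B_empty 0; exists i. Qed.

(** The value of [f] is eventually constant along the chain. In Kaplansky's terms the chain is of
    transcendental type if every nonzero polynomial is [good], and of algebraic type otherwise. *)
Definition isw f (a : value_group K) :=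
  ev (fun x => f.[x] != 0 /\ valuation f.[x] = a).

Definition good f := exists a, isw f a.

Lemma isw_uniq f a b : isw f a -> isw f b -> a = b.
Proof. by move=> fa fb; have [x [[_ <-] [_ <-]]] := ev_ex (ev_and fa fb). Qed.

Lemma iswM f g a b : isw f a -> isw g b -> isw (f * g) (a + b).
Proof.
move=> fa gb; apply: ev_mono (ev_and fa gb) => x [[f0 <-] [g0 <-]].
by rewrite hornerM mulf_neq0 // valuationM.
Qed.

Lemma iswD f g a b c : isw f a -> isw g b -> isw (f + g) c ->
  Order.min a b <= c.
Proof.
move=> fa gb fgc; have [x [[[f0 <-] [g0 <-]] [fg0 <-]]] :=
  ev_ex (ev_and (ev_and fa gb) fgc).
by rewrite hornerD in fg0 *; apply: valuationD.
Qed.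

Lemma iswC c : c != 0 -> isw c%:P (valuation c).
Proof. by move=> c0; apply: ev_all => x; rewrite hornerC. Qed.

(** Otherwise [y] would be no farther from [w] than one of [z], [z'] is, and [B_disc] would put it
    into the disc. *)
Lemma chain_sep k y w z z' : B k w -> B k z -> B k z' -> ~ B k y ->
  nlt (z - z') (y - w).
Proof.
move=> kw kz kz' ky; apply/negP => yw; apply: ky.
case/orP: (nle_total (z - w) (z' - w)) => h.
  apply: (B_disc kw kz'); rewrite [nle _ (w - _)]nleBCr (nle_trans yw) //.
  by rewrite -(subrKA w) -[w - z']opprB nleB // nle_refl.
apply: (B_disc kw kz); rewrite [nle _ (w - _)]nleBCr (nle_trans yw) //.
by rewrite -(subrKA w) -[w - z']opprB nleB // nle_refl.
Qed.

(** All points of a disc that misses [c] are at the same distance from [c]. *)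
Lemma good_XsubC c : good ('X - c%:P).
Proof.
have [k kc] := B_empty c; have [z0 kz0] := B_inhab k.
exists (valuation (z0 - c)); exists k => z kz; rewrite hornerXsubC.
have ne x : B k x -> x - c != 0.
  by move=> kx; rewrite subr_eq0; apply: contra_notN kc => /eqP <-.
split; first exact: ne.
have /nle_addr le1 : nlt (z0 - z) (z - c).
    by rewrite /nlt nleBC; exact: (chain_sep kz kz0 kz kc).
have /nle_addr le2 : nlt (z - z0) (z0 - c).
    by rewrite /nlt nleBC; exact: (chain_sep kz0 kz kz0 kc).
rewrite [_ + (z0 - z)]addrC subrKA !nleE ?ne // in le1.
rewrite [_ + (z - z0)]addrC subrKA !nleE ?ne // in le2.
by apply/eqP; rewrite eq_le le1 le2.
Qed.

(** [P y z] for [y] far along the chain and [z] still farther, that is, in a disc that no longer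
    contains [y]. *)
Definition ev2 (P : K -> K -> Prop) :=
  exists i, forall y z k, B i y -> B k z -> ~ B k y -> P y z.

Lemma ev2_and (P Q : K -> K -> Prop) :
  ev2 P -> ev2 Q -> ev2 (fun y z => P y z /\ Q y z).
Proof.
move=> [i iP] [j jQ].
case: (B_chain i j) => h; [exists i | exists j] => y z k By Bz nBy.
  by split; [apply: iP By Bz nBy | apply: jQ (h _ By) Bz nBy].
by split; [apply: iP (h _ By) Bz nBy | apply: jQ By Bz nBy].
Qed.

Lemma ev2_mono (P Q : K -> K -> Prop) :
  (forall y z, P y z -> Q y z) -> ev2 P -> ev2 Q.
Proof. by move=> PQ [i iP]; exists i => y z k By Bz /(iP _ _ _ By Bz)/PQ. Qed.

Lemma ev_ev2 (P : K -> Prop) : ev P -> ev2 (fun y z => [/\ P y, P z & z - y != 0]).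
Proof.
move=> [i iP]; exists i => y z k By Bz nBy; split; try exact: iP.
  exact/iP/(chain_nested By nBy).
by rewrite subr_eq0; apply: contra_notN nBy => /eqP <-.
Qed.

(** The exponents of [z - y] differ, so the two monomials can have the same
    norm for at most one value of [|z - y|], which shrinks along the chain. *)
Lemma ev2_compare g h a b m d : isw g a -> isw h b ->
  let s y z := g.[y] * (z - y) ^+ m in
  let t y z := h.[y] * (z - y) ^+ (m + d.+1) in
  ev2 (fun y z => nlt (s y z) (t y z)) \/ ev2 (fun y z => nlt (t y z) (s y z)).
Proof.
move=> ga hb s t; have [i0 hi0] := ev_and ga hb.
have cmp y z k : B i0 y -> B k z -> ~ B k y ->
    nlt (t y z) (s y z) = (a < b + valuation (z - y) *+ d.+1).
  move=> By Bz nBy; have [[g0 <-] [h0 <-]] := hi0 y By.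
  have zy0 : z - y != 0 by rewrite subr_eq0; apply: contra_notN nBy => /eqP <-.
  rewrite nltE ?mulf_neq0 ?expf_neq0 // !valuationM ?expf_neq0 // !valuationX //.
  by rewrite mulrnDr addrCA [valuation g.[y] + _]addrC ozmod_ltD2l.
have cmp' y z k : B i0 y -> B k z -> ~ B k y ->
    nlt (s y z) (t y z) = (b + valuation (z - y) *+ d.+1 < a).
  move=> By Bz nBy; have [[g0 <-] [h0 <-]] := hi0 y By.
  have zy0 : z - y != 0 by rewrite subr_eq0; apply: contra_notN nBy => /eqP <-.
  rewrite nltE ?mulf_neq0 ?expf_neq0 // !valuationM ?expf_neq0 // !valuationX //.
  by rewrite mulrnDr addrCA [valuation g.[y] + _]addrC ozmod_ltD2l.
case: (classic (exists y z k, [/\ B i0 y, B k z, ~ B k y &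
    a <= b + valuation (z - y) *+ d.+1])) => [[y0 [z0 [k0 [By0 Bz0 nBy0 le0]]]]|no].
  right; exists k0 => y z k By Bz nBy; have sub := chain_nested By0 nBy0.
  rewrite (cmp _ _ k) //; last exact: sub.
  apply: le_lt_trans le0 _; rewrite ozmod_ltD2l ozmod_ltMn2r //.
  have Bz' := chain_nested By nBy Bz.
  have zy0 : z - y != 0 by rewrite subr_eq0; apply: contra_notN nBy => /eqP <-.
  rewrite -nltE //; last first.
    by rewrite subr_eq0; apply: contra_notN nBy0 => /eqP <-.
  by rewrite /nlt nleBC; exact: chain_sep Bz0 Bz' By nBy0.
left; exists i0 => y z k By Bz nBy; rewrite (cmp' _ _ k) // ltNge.
by apply/negP => le; apply: no; exists y, z, k.
Qed.

(** A new term only has to be compared with the one that dominates the rest of the list. *)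
Lemma ev2_dominant (G : nat -> {poly K}) (s : seq nat) :
  uniq s -> s != [::] -> (forall j, j \in s -> good (G j)) ->
  exists2 i, i \in s & ev2 (fun y z => forall j, j \in s -> j != i ->
    nlt ((G j).[y] * (z - y) ^+ j) ((G i).[y] * (z - y) ^+ i)).
Proof.
elim: s => // n s IH /= /andP[ns us] _ gd.
have [s0|s0] := eqVneq s [::].
  exists n; first exact: mem_head.
  have [i _] := B_empty 0; exists i => y z k _ _ _ j.
  by rewrite s0 inE => ->.
have [|i si [i0 hi]] := IH us s0; first by move=> j sj; apply: gd; rewrite inE sj orbT.
have [[a na] [b ib]] : good (G n) /\ good (G i) by split; apply: gd; rewrite inE ?eqxx ?si ?orbT.
have cmp : ev2 (fun y z => nlt ((G i).[y] * (z - y) ^+ i) ((G n).[y] * (z - y) ^+ n))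
  \/ ev2 (fun y z => nlt ((G n).[y] * (z - y) ^+ n) ((G i).[y] * (z - y) ^+ i)).
  have [lt|lt|e] := ltngtP i n.
  - by have := @ev2_compare _ _ _ _ i (n - i.+1) ib na; rewrite -subSn // subSS subnKC // ltnW.
  - have := @ev2_compare _ _ _ _ n (i - n.+1) na ib.
    by rewrite -subSn // subSS subnKC; [case; [right|left] | apply: ltnW].
  - by rewrite -e si in ns.
case: cmp => cmp; [exists n | exists i]; rewrite ?inE ?eqxx ?si ?orbT //.
  apply: ev2_mono (ev2_and (ex_intro _ i0 hi) cmp) => y z [h1 h2] j.
  rewrite inE => /predU1P[->|sj jn]; first by rewrite eqxx.
  have [->//|ji] := eqVneq j i.
  by apply: nle_lt_trans h2; apply/nltW/h1.
apply: ev2_mono (ev2_and (ex_intro _ i0 hi) cmp) => y z [h1 h2] j.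
by rewrite inE => /predU1P[->|sj] // ji; apply: h1.
Qed.

(** In the Taylor expansion of [f.[z] - f.[y]] the divided derivatives have smaller degree than [f],
    so the nonzero ones are good and one term eventually dominates; it determines the value. Divided
    derivatives keep the expansion valid in positive characteristic. *)
Lemma ev2_taylor f : (1 < size f)%N ->
  (forall g, g != 0 -> (size g < size f)%N -> good g) ->
  exists m b, ev2 (fun y z => f.[z] - f.[y] != 0 /\
    valuation (f.[z] - f.[y]) = b + valuation (z - y) *+ m.+1).
Proof.
move=> f1 gd; pose G j := f^`N(j).
pose s := [seq j <- iota 1 (size f).-1 | G j != 0].
have gG j : j \in s -> good (G j).
  rewrite mem_filter mem_iota add1n prednK ?(ltnW f1) // => /and3P[G0 j1 jf].
  apply: gd => //; rewrite (leq_ltn_trans (size_poly _ _)) //.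
  by rewrite ltn_subrL j1 (ltnW f1).
have s0 : s != [::].
  (* The divided derivative of top order is the leading coefficient of [f]. *)
  suff : (size f).-1 \in s by apply: contraTneq => ->.
    rewrite mem_filter mem_iota add1n prednK ?(ltnW f1) // leqnn.
    rewrite -ltnS prednK ?(ltnW f1) // f1 !andbT.
    apply/eqP => /polyP/(_ 0); rewrite coef_nderivn addn0 binn coef0 mulr1n.
    by apply/eqP; rewrite lead_coef_eq0 -size_poly_gt0 ltnW.
have us : uniq s by rewrite filter_uniq ?iota_uniq.
have [[|i] si dom] := ev2_dominant us s0 gG; first by rewrite mem_filter mem_iota ltnn andbF in si.
have [b ib] := gG _ si; exists i, b.
apply: ev2_mono (ev2_and dom (ev_ev2 ib)) => y z [hd [[Gy0 vGy] _ zy0]].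
set t := (G i.+1).[y] * (z - y) ^+ i.+1 in hd *.
have t0 : t != 0 by rewrite mulf_neq0 ?expf_neq0.
have iN : (i.+1 < size f)%N.
  by move: si; rewrite mem_filter mem_iota add1n prednK ?(ltnW f1) // => /and3P[].
have lt_t : nlt (t - (f.[z] - f.[y])) t.
  rewrite -[z](subrKC y) nderiv_taylor; last exact: mulrC.
  rewrite (bigD1 (Ordinal (ltnW f1))) //= nderivn0 expr0 mulr1 addrAC subrr add0r.
  rewrite (bigD1 (Ordinal iN)) //= opprD addrA subrr add0r -sumrN.
  apply: nlt_sum => // j /andP[j0 ji]; rewrite /nlt nleNr.
  have [Gj0|Gj0] := eqVneq (G j) 0; first by rewrite [_^`N(_)]Gj0 horner0 mul0r nlex0.
  apply: hd; last by apply: contraNneq ji => e; apply/eqP/val_inj.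
  rewrite mem_filter Gj0 mem_iota add1n prednK ?(ltnW f1) // ltn_ord andbT lt0n.
  by apply: contraNneq j0 => e; apply/eqP/val_inj.
have /andP[l1 l2] := nlt_approx lt_t.
have fzy0 : f.[z] - f.[y] != 0 by apply: contraNneq t0 => e; rewrite -nlex0 -e.
split=> //; rewrite !nleE // in l1 l2.
have -> : valuation (f.[z] - f.[y]) = valuation t by apply/eqP; rewrite eq_le l1 l2.
by rewrite /t valuationM ?expf_neq0 // valuationX // vGy.
Qed.

(** The constant is [f.[y1]], with [y1] farther along than [y0]. As [z] is closer to [y1] than to
    [y0], the value of [f.[z] - f.[y1]] exceeds that of [f.[z] - f.[y0]], which is at least [a]. *)
Lemma good_approx f a : isw f a -> (1 < size f)%N ->
  (forall g, g != 0 -> (size g < size f)%N -> good g) ->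
  exists c, forall d, isw (f - c%:P) d -> a < d.
Proof.
move=> fa f1 gd; have [m [b [i hi]]] := ev2_taylor f1 gd; case: fa => j hj.
have [l [lj li]] : exists l, (forall x, B l x -> B i x) /\ (forall x, B l x -> B j x).
  by case: (B_chain i j) => h; [exists i | exists j]; split => // x /h.
have [y0 ly0] := B_inhab l; have [k ky0] := B_empty y0.
have kl := chain_nested ly0 ky0.
have [y1 ky1] := B_inhab k; have [n ny1] := B_empty y1.
have nk := chain_nested ky1 ny1.
exists f.[y1] => d fd.
have ev_n : ev (B n) by exists n.
have [z [[f0 <-] nz]] := ev_ex (ev_and fd ev_n) => {fd}.
rewrite hornerD hornerN hornerC in f0 *.
have kz' := nk _ nz; have lz := kl _ kz'.
have [_ ->] := hi _ _ _ (lj _ (kl _ ky1)) nz ny1.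
have [e0 e] := hi _ _ _ (lj _ ly0) kz' ky0.
apply: (@le_lt_trans _ _ (valuation (f.[z] - f.[y0]))).
  have [[fz0 <-] [fy0 vy0]] := (hj _ (li _ lz), hj _ (li _ ly0)).
  apply: le_trans (valuationD fz0 _ e0); last by rewrite oppr_eq0.
  by rewrite valuationN vy0 (hj _ (li _ lz)).2 minxx.
rewrite e ozmod_ltD2l ozmod_ltMn2r // -nltE.
- by rewrite /nlt [nle (z - y0) _]nleBC; exact: (chain_sep kz' kz' ky1 ky0).
- by rewrite subr_eq0; apply: contra_notN ny1 => /eqP <-.
- by rewrite subr_eq0; apply: contra_notN ky0 => /eqP <-.
Qed.

Definition wpoly f : value_group K := epsilon (inhabits 0) (isw f).

Lemma wpolyP f : good f -> isw f (wpoly f).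
Proof. exact: epsilon_spec. Qed.

Lemma wpolyE f a : isw f a -> wpoly f = a.
Proof. by move=> fa; apply: (isw_uniq _ fa); apply: wpolyP; exists a. Qed.

Lemma wpoly_approx f : f != 0 ->
  (forall g, g != 0 -> (size g <= size f)%N -> good g) ->
  exists c : K, f != c%:P -> wpoly f < wpoly (f - c%:P).
Proof.
move=> f0 gd; have [f1|f1] := leqP (size f) 1.
  by exists f`_0; rewrite -(size1_polyC f1) eqxx.
have fw := wpolyP (gd f f0 (leqnn _)).
have [|c hc] := good_approx fw f1; first by move=> g g0 /ltnW; apply: gd.
exists c => fc; apply/hc/wpolyP; apply: gd; rewrite ?subr_eq0 //.
rewrite (leq_trans (size_polyD _ _)) // geq_max leqnn size_polyN.
by rewrite (leq_trans (size_polyC_leq1 _)) // ltnW.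
Qed.

(** Transcendental type: eventual values define a valuation on [K[X]], and maximality would make the
    indeterminate a constant. *)
Lemma all_good_not_maximal : (forall f, f != 0 -> good f) ->
  ~ maximal_valued_field K.
Proof.
move=> gd Kmax; have [] : exists c, polyC c = 'X :> {poly K}; last first.
  move=> c /(congr1 (fun p : {poly K} => size p)); rewrite size_polyX size_polyC.
  by case: eqP.
apply: (@maximal_domain_onto K {poly K} polyC wpoly) => //.
- move=> x y x0 y0; apply: wpolyE.
  by apply: iswM; apply/wpolyP/gd.
- move=> x y x0 y0 xy0; apply: (@iswD x y); apply: wpolyP; exact: gd.
- by move=> c c0; apply/wpolyE/iswC.
- by move=> x x0; apply: wpoly_approx x0 _ => g g0 _; apply: gd.
Qed.

(** Algebraic type: [q] is irreducible because products of good polynomials are good. Nonzero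
    classes modulo [q] are represented by good polynomials, whose eventual values define a valuation
    on the quotient. Maximality would put the class of [X] in [K], although [q] has degree at least
    2. *)
Lemma min_bad_not_maximal q : q \is monic -> ~ good q ->
  (forall g, g != 0 -> (size g < size q)%N -> good g) ->
  ~ maximal_valued_field K.
Proof.
move=> qm qb gd; have q0 := monic_neq0 qm.
have q2 : (2 < size q)%N.
  case: ltngtP => // [q2|q2].
    case: qb; have /size1_polyC qc : (size q <= 1)%N by [].
    by rewrite qc; exists (valuation q`_0); apply: iswC; rewrite -polyC_eq0 -qc.
  case: qb; suff -> : q = 'X - (- q`_0)%:P by apply: good_XsubC.
  apply/polyP => -[|[|i]]; rewrite coefB coefX coefC /= ?sub0r ?opprK ?subr0 //.
    by have /monicP := qm; rewrite /lead_coef -q2.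
  by rewrite nth_default -?q2 //= oppr0.
have qi : irreducible_poly q.
  split=> [|p p1 pq]; first by rewrite (ltn_trans _ q2).
  have p0 : p != 0 by apply: contraTneq pq => ->; rewrite dvd0p.
  rewrite -dvdp_size_eqp //; apply/negPn/negP => spq.
  have {}spq : (size p < size q)%N by rewrite ltn_neqAle spq dvdp_leq.
  have /dvdpP[r qE] := pq.
  have r0 : r != 0 by apply: contraNneq q0 => r0; rewrite qE r0 mul0r.
  have [a pa] := gd _ p0 spq.
  have [|b rb] := gd _ r0; last by apply: qb; rewrite qE; exists (b + a); apply: iswM.
  have p2 : (1 < size p)%N by rewrite ltn_neqAle eq_sym p1 size_poly_gt0.
  by rewrite qE size_mul // -subn1 ltn_subRL addnC ltn_add2l.
have qmi : monic_irreducible_poly q by [].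
have sz (x : {poly %/ q with qmi}) : (size (x : {poly K}) < size q)%N.
  by apply: leq_trans (size_mk_monic x) _; rewrite (mk_monicE qmi).
have gd' (x : {poly %/ q with qmi}) : x != 0 -> good (x : {poly K}).
  by move=> x0; apply: gd.
move=> Kmax; have [] : exists c, qpolyC q c = 'qX; last first.
  move=> c /(congr1 (fun p : {poly %/ q} => size (p : {poly K}))).
  by rewrite qpolyXE // size_polyX /= size_polyC; case: eqP.
apply: (@maximal_domain_onto K {poly %/ q with qmi} (qpolyC q) (fun x => wpoly x)) => //.
- move=> x y x0 y0; apply: wpolyE.
  set r : {poly K} := x * y; have xy0 : x * y != 0 by rewrite mulf_neq0.
  have [wx wy wr] := And3 (wpolyP (gd' _ x0)) (wpolyP (gd' _ y0)) (wpolyP (gd' _ xy0)).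
  have xyE := Pdiv.RingMonic.rdivp_eq qm ((x : {poly K}) * y).
  set h := Pdiv.CommonRing.rdivp _ _ in xyE; have {}xyE : (x : {poly K}) * y = h * q + r.
    rewrite xyE /r poly_of_qpolyM; congr (_ + Pdiv.CommonRing.rmodp _ _).
    by rewrite (mk_monicE qmi).
  have wxy := iswM wx wy.
  have [h0|h0] := eqVneq h 0; first by rewrite -[X in isw X]add0r -[0](mul0r q) -h0 -xyE.
  have [c hc] : good h.
    apply: gd => //; rewrite ltnNge; apply/negP => qh.
    have : (size (h * q)%R <= maxn (size ((x : {poly K}) * y)%R) (size r))%N.
      rewrite -[h * q](addrK r) -xyE -(size_polyN r); exact: size_polyD.
    rewrite !size_mul // leq_max.
    move: (sz x) (sz y) (sz (x * y)) qh q2; rewrite -/r.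
    move: (size _) (size _) (size _) (size _) (size _) => /= *; lia.
  have [<- //|ne] := eqVneq (wpoly r) (wpoly x + wpoly y).
  (* If the product [h * q + r] and its remainder [r] had different eventual values, [h * q] would
     have the smaller one, and [q] would be good because [h] is. *)
  case: qb; exists (Order.min (wpoly x + wpoly y) (wpoly r) - c).
  apply: ev_mono (ev_and wxy (ev_and wr hc)) => z [[e1 e2] [[e3 e4] [e5 e6]]].
  have := @valuationB_neq _ _ _ e1 e3; rewrite e2 e4 eq_sym => /(_ ne).
  rewrite -hornerN -hornerD xyE addrK hornerM mulf_eq0 negb_or => -[/andP[_ q0z]].
  by rewrite valuationM // e6 addrC => <-; rewrite addrK.
- move=> x y x0 y0 xy0; apply: (@iswD x y); apply: wpolyP;
    [exact: (gd' x x0) | exact: (gd' y y0) | exact: (gd' (x + y) xy0)].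
- by move=> c c0; apply/wpolyE/iswC.
- move=> x x0; apply: wpoly_approx x0 _ => g g0 gx.
  by apply: gd => //; apply: leq_ltn_trans (sz x).
Qed.

End EmptyChain.

(** A chain with empty intersection is of one of the two types, and each contradicts maximality.
    Strong induction makes a bad polynomial minimal; scaling makes it monic. *)
Lemma maximal_spherically_complete (K : valuedField) :
  maximal_valued_field K -> spherically_complete K.
Proof.
move=> Kmax I B Bne Bch Bdi; apply: NNPP => no.
have Bem x : exists i, ~ B i x.
  by apply: not_all_ex_not => h; apply: no; exists x.
suff : forall n (f : {poly K}), (size f <= n)%N -> f != 0 -> good B f.
  move=> gd; apply: (all_good_not_maximal Bne Bch Bdi Bem _ Kmax) => f.
  exact: gd (leqnn _).
elim/ltn_ind => n IH f fn f0; apply: NNPP => bad.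
pose q := (lead_coef f)^-1 *: f.
have l0 : (lead_coef f)^-1 != 0 by rewrite invr_eq0 lead_coef_eq0.
apply: (@min_bad_not_maximal K I B Bne Bch Bdi Bem q) => //.
- by rewrite monicE lead_coefZ mulVf // -invr_eq0.
- case=> a qa; apply: bad; exists (valuation (lead_coef f) + a).
  have fE : (lead_coef f)%:P * q = f.
    by rewrite mul_polyC scalerA mulfV ?scale1r // -invr_eq0.
  by rewrite -[X in isw _ X]fE; apply: (iswM Bch _ qa); apply: (iswC Bem); rewrite -invr_eq0.
move=> g g0; rewrite size_scale // => gf; apply: (IH (size g)) => //.
exact: leq_trans gf fn.
Qed.

(** * Norms on finite-dimensional spaces *)

Section LinearCombinations.

Variables (F E : fieldType) (f : {rmorphism F -> E}) (I : eqType) (b : I -> E).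
Implicit Types (c d : I -> F) (r : seq I).

Definition lincomb r c : E := \sum_(i <- r) f (c i) * b i.

Definition free_over r : Prop :=
  forall c, lincomb r c = 0 -> forall i, i \in r -> c i = 0.

Lemma lincombB r c d :
  lincomb r (fun i => c i - d i) = lincomb r c - lincomb r d.
Proof.
by rewrite /lincomb -sumrB; apply: eq_bigr => i _; rewrite rmorphB mulrBl.
Qed.

Lemma lincombZ r a c : lincomb r (fun i => a * c i) = f a * lincomb r c.
Proof.
by rewrite /lincomb mulr_sumr; apply: eq_bigr => i _; rewrite rmorphM mulrA.
Qed.

Lemma eq_lincomb r c d : {in r, c =1 d} -> lincomb r c = lincomb r d.
Proof. by move=> cd; apply: eq_big_seq => i ri; rewrite cd. Qed.

End LinearCombinations.

Section NearBest.

Variables (K L : valuedField) (f : {rmorphism K -> L}).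
Hypothesis f_nle : forall a b : K, nle (f a) (f b) = nle a b.
Hypothesis K_sc : spherically_complete K.

(** Each coordinate of the near-best approximant is a common point of a chain of
    discs of [K], one for every competing linear combination. *)
Lemma near_best_approx (I : eqType) (b : I -> L) (r : seq I) (C : L) :
    nle 1 C ->
    (forall c i, i \in r -> nle (f (c i) * b i) (C * lincomb f b r c)) ->
  forall y, exists c, forall d,
    nle (y - lincomb f b r c) (C * (y - lincomb f b r d)).
Proof.
move=> C1 Hb y; pose S := lincomb f b r.
have coord i : exists x : K, i \in r ->
    forall d : I -> K, nle (f (x - d i) * b i) (C * (y - S d)).
  have [ri|nri] := boolP (i \in r); last by exists 0.
  have [|||x hx] := @K_sc (I -> K)
    (fun d x => nle (f (x - d i) * b i) (C * (y - S d))).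
  - by move=> d; exists (d i); rewrite subrr rmorph0 mul0r nle0.
  - have sub d d' : nle (y - S d) (y - S d') -> forall x,
        nle (f (x - d i) * b i) (C * (y - S d)) ->
        nle (f (x - d' i) * b i) (C * (y - S d')).
      move=> dd' x hx; rewrite -(subrKA (d i)) rmorphD mulrDl nleD //.
        by apply: nle_trans hx _; apply: nleM (nle_refl _) dd'.
      apply: nle_trans (Hb (fun i => d i - d' i) i ri) _.
      apply: nleM (nle_refl _) _; rewrite lincombB -/(S d) -/(S d').
      by rewrite -(subrKA y) addrC nleD ?nle_refl // nleBC.
    by move=> d d'; case/orP: (nle_total (y - S d) (y - S d')) => /sub; [left|right].
  - move=> d x x' z hx hx' zx; rewrite -(subrKA x) rmorphD mulrDl nleD //.
    apply: (@nle_trans _ (f (x - x') * b i)).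
      by apply: nleM (nle_refl _); rewrite f_nle.
    rewrite -(subrKA (d i)) rmorphD mulrDl nleD //.
    by rewrite -opprB rmorphN mulNr nleN.
  by exists x.
have [c hc] := functional_choice coord.
exists c => d; rewrite -/(S c) -/(S d) -(subrKA (S d)) nleD //.
  by rewrite -[X in nle X]mul1r; apply: nleM (nle_refl _).
rewrite nleBC -lincombB /lincomb big_seq; apply: nle_sum => i ri.
exact: hc.
Qed.

End NearBest.

Section NormEquivalence.

Variables (K L : valuedField) (i : valuedExt K L).
Local Notation f := (ext_embed i).

Lemma nle_bound_seq (V : valuedField) (s : seq V) :
  exists2 C : V, C != 0 & {in s, forall x, nle x C}.
Proof.
elim: s => [|a s [C C0 hC]]; first by exists 1; rewrite ?oner_neq0.
case/orP: (nle_total a C) => h; first by exists C => // x; rewrite inE => /predU1P[->|/hC].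
exists a => [|x]; first by apply: contraNneq C0 => a0; rewrite -nlex0 -a0.
by rewrite inE => /predU1P[->|/hC /nle_trans]; [rewrite nle_refl | apply].
Qed.

(** [C] bounds 1 and the coefficients of a monic equation of [y]; if [y] were larger than [C], the
    leading term would strictly dominate the others. *)
Lemma algebraic_bounded : algebraic_ext f ->
  forall y : L, exists2 C : K, C != 0 & nle y (f C).
Proof.
move=> alg y; have /integral_algebraic[p pm py] := alg y.
have [C C0 hC] := nle_bound_seq (1 :: p).
exists C => //; apply/negPn/negP => Cy.
have C1 : nle 1 C by apply: hC; rewrite mem_head.
have y1 : nle 1 y by apply: nle_trans (nltW Cy); rewrite -(rmorph1 f) nle_ext.
have y0 := nlt_neq0 Cy.
have [n sp] : exists n, size p = n.+1.
  by exists (size p).-1; rewrite prednK // size_poly_gt0 monic_neq0.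
move: py; rewrite /root horner_coef size_map_poly sp big_ord_recr /= coef_map /=.
have -> : p`_n = 1 by move/monicP: pm; rewrite /lead_coef sp.
rewrite rmorph1 mul1r addrC addr_eq0 => /eqP yn.
have : nlt (y ^+ n) (y ^+ n); last by rewrite nltxx.
rewrite {1}yn /nlt nleNr; apply: nlt_sum; first by rewrite expf_neq0.
move=> j _; rewrite coef_map.
apply: (@nlt_le_trans _ (y * y ^+ j)); last first.
  rewrite -exprS -[X in nle _ (y ^+ X)](subnK (ltn_ord j)) exprD -[X in nle X]mul1r.
  by apply: nleM (nle_refl _); rewrite -(expr1n _ (n - j.+1)) nleX.
rewrite ![_ * y ^+ j]mulrC nltM2l ?expf_neq0 //.
apply: nle_lt_trans Cy; rewrite nle_ext hC // inE mem_nth ?orbT //.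
by rewrite sp ltnS ltnW.
Qed.

Hypothesis bounded : forall y : L, exists2 C : K, C != 0 & nle y (f C).

Lemma bounded_seq (s : seq L) :
  exists2 C : K, C != 0 & {in s, forall x, nle x (f C)}.
Proof.
have [C _ hC] := nle_bound_seq s; have [D D0 CD] := bounded C.
by exists D => // x /hC /nle_trans; apply.
Qed.

Hypothesis K_sc : spherically_complete K.

(** Coordinates on the span of [r] being bounded, [b k] has a near-best approximation there. Its
    error [e], nonzero by freeness, bounds the coordinate at [k]; subtracting that term leaves the
    others to the induction hypothesis. *)
Lemma norm_equivalence (I : eqType) (b : I -> L) (r : seq I) :
  uniq r -> free_over f b r ->
  exists2 C : K, C != 0 &
    forall c j, j \in r -> nle (f (c j)) (f C * lincomb f b r c).
Proof.
elim: r => [|k r IH] /=; first by exists 1; rewrite ?oner_neq0.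
case/andP=> kr ur fr.
have lc c : lincomb f b (k :: r) c = f (c k) * b k + lincomb f b r c.
  by rewrite /lincomb big_cons.
have ext (a : K) c : exists d, d k = a /\ {in r, c =1 d}.
  exists (fun j => if j == k then a else c j); rewrite eqxx; split=> // j rj.
  by case: eqP => // jk; rewrite jk (negPf kr) in rj.
have [|C C0 hC] := IH ur.
  move=> c c0 j rj; have [d [d0 cd]] := ext 0 c; rewrite cd //.
  apply: fr; last by rewrite inE rj orbT.
  by rewrite lc d0 rmorph0 mul0r add0r -(eq_lincomb _ _ cd).
have [D D0 hD] := bounded_seq (1 :: [seq f C * b j | j <- r]).
have D1 : nle 1 (f D) by apply: hD; rewrite mem_head.
have hb c j : j \in r -> nle (f (c j) * b j) (f D * lincomb f b r c).
  move=> rj; apply: (@nle_trans _ (f C * lincomb f b r c * b j)).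
    by apply: nleM (nle_refl _); apply: hC.
  rewrite mulrAC; apply: nleM (nle_refl _); apply: hD.
  by rewrite inE; apply/orP; right; apply/mapP; exists j.
have [c0 hc0] := near_best_approx (nle_ext i) K_sc D1 hb (b k).
set e := b k - _ in hc0; have e0 : e != 0.
  apply/eqP => e0; have [d [d1 cd]] := ext (-1) c0.
  have /fr/(_ k (mem_head _ _)) : lincomb f b (k :: r) d = 0.
    by rewrite lc d1 -(eq_lincomb _ _ cd) rmorphN rmorph1 mulN1r addrC -opprB -/e e0 oppr0.
  by rewrite d1 => /eqP; rewrite oppr_eq0 oner_eq0.
have [A A0 hA] := bounded (f D / e).
have hk c : nle (f (c k)) (f A * lincomb f b (k :: r) c).
  have [->|ck0] := eqVneq (c k) 0; first by rewrite rmorph0 nle0.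
  have fck0 : f (c k) != 0 by rewrite fmorph_eq0.
  (* For this competitor the distance to [b k] is the norm of the whole combination divided by
     [c k]. *)
  have := hc0 (fun j => - (c k)^-1 * c j).
  rewrite lincombZ rmorphN fmorphV mulNr opprK.
  have -> : b k + (f (c k))^-1 * lincomb f b r c = lincomb f b (k :: r) c / f (c k).
    by rewrite lc mulrDl mulrAC mulfV // mul1r [_ / _]mulrC.
  rewrite mulrA -(nleM2r _ _ fck0) divfK // => h.
  rewrite -(nleM2l _ _ e0); apply: nle_trans h _.
  rewrite mulrA; apply: nleM (nle_refl _).
  by move: hA; rewrite -(nleM2l _ _ e0) mulrCA mulfV // mulr1.
have [G G0 hG] := bounded_seq [:: 1; f A * b k].
have [H H0 hH] := nle_bound_seq [:: A; C * G].
exists H => // c j; rewrite inE => /predU1P[->|rj].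
  apply: nle_trans (hk c) _; apply: nleM (nle_refl _).
  by rewrite nle_ext hH ?mem_head.
apply: nle_trans (hC c j rj) _.
apply: (@nle_trans _ (f (C * G) * lincomb f b (k :: r) c)); last first.
  by apply: nleM (nle_refl _); rewrite nle_ext hH // !inE eqxx orbT.
rewrite rmorphM -mulrA; apply: nleM (nle_refl _) _.
have -> : lincomb f b r c = lincomb f b (k :: r) c - f (c k) * b k.
  by rewrite lc addrAC subrr add0r.
apply: nleB.
  rewrite -[X in nle X]mul1r; apply: nleM (nle_refl _); apply: hG.
  exact: mem_head.
apply: (@nle_trans _ (f A * lincomb f b (k :: r) c * b k)).
  by apply: nleM (nle_refl _).
by rewrite mulrAC; apply: nleM (nle_refl _); apply: hG; rewrite !inE eqxx orbT.
Qed.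

End NormEquivalence.

(** * The degree of K over its p-th powers *)

(** The coefficient matrix has more rows than columns, so its left kernel contains a nonzero
    relation over [F]. *)
Lemma span_dependent (F E : fieldType) (f : {rmorphism F -> E}) (n m : nat)
    (x : 'I_n -> E) (e : 'I_m -> E) (A : 'I_n -> 'I_m -> F) :
  (m < n)%N -> (forall i, x i = \sum_j f (A i j) * e j) ->
  exists2 c : 'I_n -> F, exists i, c i != 0 & \sum_i f (c i) * x i = 0.
Proof.
move=> mn xE; pose M := \matrix_(i, j) A i j.
have kM0 : kermx M != 0.
  by rewrite kermx_eq0 /row_free neq_ltn (leq_ltn_trans (rank_leq_col _)).
pose u := nz_row (kermx M); have uM : u *m M = 0 by apply/sub_kermxP/nz_row_sub.
exists (fun i => u 0 i).
  apply: NNPP => no; case/eqP: kM0; apply/eqP; rewrite -nz_row_eq0.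
  apply/eqP/rowP => i; rewrite mxE; apply/eqP/negPn/negP => ui0.
  by apply: no; exists i.
under eq_bigr do rewrite xE mulr_sumr.
rewrite exchange_big /=; apply: big1 => j _.
under eq_bigr do rewrite mulrA -rmorphM.
rewrite -mulr_suml -rmorph_sum /=.
have /matrixP/(_ 0 j) := uM; rewrite !mxE => uMj.
rewrite (_ : \sum_(k < n) _ = \sum_k u 0 k * M k j); last first.
  by apply: eq_bigr => k _; congr (_ * _); rewrite mxE.
by rewrite uMj rmorph0 mul0r.
Qed.

Lemma span_dependent_fin (F E : fieldType) (f : {rmorphism F -> E}) (n : nat)
    (J : finType) (x : 'I_n -> E) (e : J -> E) (A : 'I_n -> J -> F) :
  (#|J| < n)%N -> (forall i, x i = \sum_j f (A i j) * e j) ->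
  exists2 c : 'I_n -> F, exists i, c i != 0 & \sum_i f (c i) * x i = 0.
Proof.
move=> Jn xE; apply: (span_dependent (e := fun j => e (enum_val j))
  (A := fun i j => A i (enum_val j)) Jn) => i.
by rewrite xE (reindex_onto enum_val enum_rank) => [|j _]; rewrite ?enum_rankK //;
  apply: eq_bigl => j; rewrite enum_valK eqxx.
Qed.

Lemma bounded_max (P : nat -> Prop) (N : nat) :
  (exists n, P n) -> (forall n, P n -> (n <= N)%N) ->
  exists n, P n /\ forall m, P m -> (m <= n)%N.
Proof.
move=> [n Pn] hN; pose b m : bool := if excluded_middle_informative (P m) then true else false.
have bP m : reflect (P m) (b m).
  by rewrite /b; case: excluded_middle_informative => h; constructor.
have exb : exists m, b m by exists n; apply/bP.
have hb m : b m -> (m <= N)%N by move/bP/hN.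
case: (ex_maxnP exb hb) => m /bP Pm mmax; exists m; split=> // k /bP; exact: mmax.
Qed.

Section FrobeniusDegree.

Variables (K : valuedField) (p : nat).
Hypothesis pK : p \in [pchar K].
Local Notation v := (@valuation K).
Local Notation phi := (pFrobenius_aut pK).

Let p_pr : prime p := pcharf_prime pK.

Lemma nle_frobenius (a b : K) : nle (phi a) (phi b) = nle a b.
Proof.
by rewrite !pFrobenius_autE -(prednK (prime_gt0 p_pr)) nleXE.
Qed.

(** Valuation independence over [K^p], which is presented as [K] acting through the Frobenius
    [phi]. *)
Definition orthogonal_over n (b : nat -> K) := forall c i, (i < n)%N ->
  nle (phi (c i) * b i) (lincomb phi b (index_iota 0 n) c).

Lemma residue_pchar : p \in [pchar residue_field K].
Proof.
rewrite inE p_pr /=; apply/eqP; rewrite -(rmorph_nat (@residue K)).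
have -> : (p%:R : vring K) = 0; last by rewrite rmorph0.
apply: val_inj; rewrite /= -[RHS](pcharf0 pK).
by elim: (p) => // n IH; rewrite !mulrS -IH.
Qed.

Lemma residue_neq0 (x : vring K) : residue x != 0 -> nle 1 (vring_val x).
Proof.
rewrite residue_eq0 unfold_in /maximal_ideal negb_or -leNgt => /andP[x0 vx].
by rewrite nleE ?oner_neq0 // valuation1.
Qed.

Lemma residue_eq0_lt (x : vring K) : residue x = 0 -> nlt (vring_val x) 1.
Proof.
move/eqP; rewrite residue_eq0 unfold_in /maximal_ideal => /orP[/eqP->|vx].
  by rewrite nlt0 oner_neq0.
have [->|x0] := eqVneq (vring_val x) 0; first by rewrite nlt0 oner_neq0.
by rewrite nltE ?oner_neq0 // valuation1.
Qed.

(** Pigeonhole: among more than [size s * size u] elements, more than [size u] have values in one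
    coset of [p vK]. Scaled by [p]-th powers to a common value and divided by one of them, they
    become units whose residues are dependent over [(Kv)^p]. Lifting the dependence yields a
    combination smaller than one of its terms. *)
Lemma orthogonal_bounded : finite_index_multiples (value_group K) p ->
  finite_p_degree (residue_field K) p ->
  exists N, forall n b, (forall i, (i < n)%N -> b i != 0) ->
    orthogonal_over n b -> (n <= N)%N.
Proof.
move=> [s hs] [u hu]; exists (size s * size u)%N => n b b0 orth.
have coset (i : 'I_n) : exists j : 'I_(size s), exists d : K, d != 0 /\
    v (phi d * b i) = s`_j.
  have [g gs [h gh]] := hs (v (b i)); have [d d0 dh] := valuation_onto (- h).
  have js : (index g s < size s)%N by rewrite index_mem.
  exists (Ordinal js), d; split=> //=.
  rewrite valuationM ?fmorph_eq0 ?b0 // pFrobenius_autE valuationX // dh.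
  by rewrite nth_index // mulNrn -gh opprB subrK.
have [idx hidx] := functional_choice coset.
have [d hd] := functional_choice hidx.
rewrite leqNgt; apply/negP => big.
have [j jbig] : exists j, (size u < #|[set i | idx i == j]|)%N.
  apply: NNPP => no; move: big; rewrite ltnNge => /negP; apply.
  rewrite -{1}[n]card_ord -sum1_card (partition_big idx predT) //=.
  have -> : (size s * size u)%N = (\sum_(j < size s) size u)%N.
    by rewrite sum_nat_const card_ord.
  apply: leq_sum => j _.
  rewrite sum1dep_card leqNgt; apply/negP => h; apply: no; exists j.
  by rewrite cardsE in h *; exact: h.
set A := [set i | idx i == j] in jbig.
have Aidx (k : 'I_#|A|) : idx (enum_val k) = j.
  by have := enum_valP k; rewrite inE => /eqP.
have k0 : 'I_#|A| by apply: (Ordinal (leq_ltn_trans (leq0n _) jbig)).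
pose w (k : 'I_#|A|) : K := phi (d (enum_val k)) * b (enum_val k).
have w0 k : w k != 0 by rewrite mulf_neq0 ?fmorph_eq0 ?(hd _).1 // b0.
have vw k : v (w k / w k0) = 0.
  rewrite valuationM ?invr_eq0 // valuationV //.
  by rewrite (hd (enum_val k)).2 (hd (enum_val k0)).2 !Aidx subrr.
have wO k : w k / w k0 \in @valuation_ring K.
  by rewrite unfold_in /valuation_ring vw lexx orbT.
pose x (k : 'I_#|A|) := residue (VRing (wO k)).
pose phik := pFrobenius_aut residue_pchar.
have phikE z : phik z = z ^+ p by exact: pFrobenius_autE.
have xspan k : exists a : 'I_(size u) -> residue_field K,
    x k = \sum_l phik (a l) * u`_l.
  have [a [/functional_choice[a' ha'] ->]] := hu (x k); exists a'.
  by apply: eq_bigr => l _; rewrite phikE ha'.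
have [M xE] := functional_choice xspan.
have [c [k1 ck1] sum0] := span_dependent jbig xE.
pose t k := repr (c k); have tc k : residue (t k) = c k by rewrite /residue reprK.
have lt1 : nlt (\sum_k phi (vring_val (t k)) * (w k / w k0)) 1.
  have := @residue_eq0_lt (\sum_k t k ^+ p * VRing (wO k)).
  have -> : vring_val (\sum_k t k ^+ p * VRing (wO k)) =
            \sum_k phi (vring_val (t k)) * (w k / w k0).
    rewrite (big_morph (@vring_val K) (@vringD K) (vring0 K)).
    apply: eq_bigr => k _; rewrite vringM pFrobenius_autE; congr (_ * _).
    by elim: (p) => // m IH; rewrite !exprS vringM IH.
  apply; rewrite rmorph_sum /= -[RHS]sum0; apply: eq_bigr => k _.
  by rewrite rmorphM rmorphXn /= tc -phikE.
(* The lifted coefficients, extended by 0 outside [A]; the sum has at most one term. *)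
pose c' (i : nat) : K :=
  \sum_(k : 'I_#|A| | val (enum_val k) == i) vring_val (t k) * d (enum_val k).
have c'E (k : 'I_#|A|) : c' (val (enum_val k)) = vring_val (t k) * d (enum_val k).
  rewrite /c' (big_pred1 k) // => k'; apply/eqP/eqP => [/val_inj/enum_val_inj //|-> //].
have sumE : lincomb phi b (index_iota 0 n) c' = \sum_k phi (vring_val (t k)) * w k.
  rewrite /lincomb big_mkord (bigID (mem A)) /= [X in _ + X]big1 => [|i iA].
    rewrite addr0 big_enum_val /=; apply: eq_bigr => k _.
    by rewrite c'E rmorphM mulrA.
  rewrite /c' big_pred0 ?rmorph0 ?mul0r // => k; apply/negP => /eqP/val_inj e.
  by move: (enum_valP k); rewrite e (negPf iA).
have := orth c' (enum_val k1) (ltn_ord _); rewrite sumE c'E rmorphM -mulrA.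
apply/negP; rewrite -/(nlt _ _).
rewrite -/(w k1).
apply: (@nlt_le_trans _ (w k0)).
  rewrite -[X in nlt _ X]mulr1.
  have -> : \sum_k phi (vring_val (t k)) * w k =
    w k0 * \sum_k phi (vring_val (t k)) * (w k / w k0).
    rewrite mulr_sumr; apply: eq_bigr => k _.
    by rewrite [RHS]mulrCA [w k0 * _]mulrC divfK.
  by rewrite nltM2l.
apply: (@nle_trans _ (w k1)).
  move/eqP: (vw k1); rewrite valuationM ?invr_eq0 // valuationV // subr_eq0.
  by rewrite nleE // => /eqP->.
rewrite -[X in nle X]mul1r; apply: nleM (nle_refl _).
by rewrite -(rmorph1 phi) nle_frobenius; apply: residue_neq0; rewrite tc.
Qed.

(** A maximal orthogonal family spans: the error of a best approximation by its
    span would extend it. *)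
Lemma frobenius_spanned : spherically_complete K ->
  finite_index_multiples (value_group K) p ->
  finite_p_degree (residue_field K) p ->
  exists n (b : nat -> K), forall y,
    exists c, y = lincomb phi b (index_iota 0 n) c.
Proof.
move=> Ksc fi fd; have [N hN] := orthogonal_bounded fi fd.
pose P n := exists b, (forall i, (i < n)%N -> b i != 0) /\ orthogonal_over n b.
have [n [[b [b0 orth]] nmax]] : exists n, P n /\ forall m, P m -> (m <= n)%N.
  apply: bounded_max; last by move=> n [b [b0 orth]]; apply: hN orth.
  by exists 0%N, (fun=> 0); split=> // c i.
exists n, b => y; apply: NNPP => ny.
have hb c i : i \in index_iota 0 n ->
    nle (phi (c i) * b i) (1 * lincomb phi b (index_iota 0 n) c).
  by rewrite mul1r mem_index_iota; apply: orth.
have [c hc] := near_best_approx nle_frobenius Ksc (nle_refl 1) hb y.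
set e := y - _ in hc; have e0 : e != 0.
  by apply/eqP => /subr0_eq yE; apply: ny; exists c.
suff : P n.+1 by move/nmax; rewrite ltnn.
pose b' i := if i == n then e else b i; exists b'; split=> [i|d i].
  rewrite ltnS leq_eqVlt /b'; case: eqP => //= _; exact: b0.
have lc : lincomb phi b' (index_iota 0 n.+1) d =
    lincomb phi b (index_iota 0 n) d + phi (d n) * e.
  rewrite /lincomb big_nat_recr //= {2}/b' eqxx; congr (_ + _).
  by apply: eq_big_nat => j /andP[_ jn]; rewrite /b' (ltn_eqF jn).
have le_e : nle (phi (d n) * e) (lincomb phi b' (index_iota 0 n.+1) d).
  rewrite lc; have [->|dn0] := eqVneq (d n) 0; first by rewrite rmorph0 mul0r nle0.
  have pdn0 : phi (d n) != 0 by rewrite fmorph_eq0.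
  (* The error of this competitor, multiplied by [phi (d n)], is the new combination. *)
  have := hc (fun i => c i - (d n)^-1 * d i).
  rewrite lincombB lincombZ mul1r opprB addrCA -/e fmorphV.
  rewrite -(nleM2l _ _ pdn0) => h; apply: (eq_ind _ (fun X => is_true (nle _ X)) h).
  by rewrite mulrDr; congr (_ + _); exact: (mulVKf pdn0).
rewrite ltnS leq_eqVlt => /predU1P[->|ilt]; first by rewrite /b' eqxx.
rewrite /b' (ltn_eqF ilt) -/b'; apply: nle_trans (orth d i ilt) _.
rewrite -[X in nle X _](addrK (phi (d n) * e)) -lc nleB //; exact: nle_refl.
Qed.

End FrobeniusDegree.

(** * Elements of unbounded degree *)

Section Degrees.

Variables (F E : fieldType) (f : {rmorphism F -> E}).
Implicit Types (p q : {poly F}) (y : E).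
Local Notation "p ^ g" := (map_poly g p) : ring_scope.

Definition degree_le (D : nat) y :=
  exists p, [/\ p != 0, (size p <= D.+1)%N & root (p ^ f) y].

Definition unbounded_degree := forall D, exists y, ~ degree_le D y.

Definition separable_over y := exists2 q, separable_poly q & root (q ^ f) y.

Lemma modp_eval p q y : p != 0 -> root (p ^ f) y -> ((q %% p) ^ f).[y] = (q ^ f).[y].
Proof.
move=> p0 /eqP py; rewrite [in RHS](divp_eq q p) rmorphD rmorphM /= hornerD hornerM.
by rewrite py mulr0 add0r.
Qed.

Lemma eval_coef n p y : (size p <= n)%N -> (p ^ f).[y] = \sum_(i < n) f p`_i * y ^+ i.
Proof.
move=> pn; rewrite (@horner_coef_wide _ n) ?size_map_poly //.
by apply: eq_bigr => i _; rewrite coef_map.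
Qed.

Lemma spanned_finite_degree n (e : nat -> E) :
  (forall y, exists c, y = lincomb f e (index_iota 0 n) c) ->
  finite_degree_over (fun y : E => exists x : F, f x = y).
Proof.
move=> h; exists (mkseq e n) => y; have [c ->] := h y.
exists (fun k : 'I__ => f (c (val k))); split=> [k|]; first by eexists.
rewrite /lincomb -(big_mkord xpredT (fun k => f (c k) * (mkseq e n)`_k)) size_mkseq.
by apply: eq_big_nat => k /andP[_ kn]; rewrite nth_mkseq.
Qed.

Hypothesis F_inf : forall q : {poly E}, q != 0 -> exists x : F, ~~ root q (f x).

(** For [t] of maximal degree, a primitive element of [F(t, y)] has the same
    degree as [t], so it already lies in [F(t)]. *)
Lemma separable_in_simple (D : nat) : (forall y, degree_le D y) ->
  exists n (t : E), forall y, separable_over y ->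
    forall k, exists a : nat -> F, y ^+ k = \sum_(i < n) f (a i) * t ^+ i.
Proof.
move=> deg; pose P n := exists t, ~ degree_le n t.
have [[n [[t tn] nmax]]|noP] := classic (exists n, P n /\ forall m, P m -> (m <= n)%N); last first.
  have {}noP : ~ exists n, P n.
    move=> exP; apply: noP; apply: (bounded_max (N := D)) exP _ => m [t].
    apply: contra_notT; rewrite -ltnNge => Dm; have [p [p0 sp py]] := deg t.
    by exists p; split=> //; apply: leq_trans sp _; rewrite ltnS ltnW.
  (* A nonzero constant has no root, so no element has degree at most 0. *)
  have [p [p0 sp /=]] : degree_le 0 1 by apply: NNPP => h; apply: noP; exists 0%N, 1.
  by rewrite (size1_polyC sp) map_polyC rootC fmorph_eq0 -polyC_eq0 -size1_polyC ?(negPf p0).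
have degS y : degree_le n.+1 y.
  by apply: NNPP => h; have := nmax n.+1 (ex_intro _ y h); rewrite ltnn.
have [p [p0 sp pt]] := degS t.
exists n.+1, t => y [q sq qy] k.
suff [r ryE] : exists r, (r ^ f).[t] = y.
  exists (fun i => (r ^+ k %% p)`_i); rewrite -eval_coef.
    by rewrite modp_eval // rmorphXn /= horner_exp ryE.
  by rewrite -ltnS (leq_trans _ sp) // ltn_modp.
have [r r0 PET] := large_field_PET p0 pt qy sq.
have [x rx] := F_inf r0; have [[q1 q1z] [q2 q2z]] := PET x rx.
set z := f x * y - t in q1z q2z.
have [m [m0 sm mz]] := degS z.
(* [u] lists [y] and then [1, t, ..., t^n]: these [n + 2] elements lie in the span of
   [1, z, ..., z^n], hence are dependent. The coefficient of [y] is nonzero because [t] is a root of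
   no nonzero polynomial of degree at most [n]. *)
pose u (i : 'I_n.+2) : E := oapp (fun j : 'I_n.+1 => t ^+ j) y (unlift ord0 i).
have uE i : exists a : 'I_n.+1 -> F, u i = \sum_j f (a j) * z ^+ j.
  have [s <-] : exists s, (s ^ f).[z] = u i.
    rewrite /u; case: unliftP => [j|] _ /=; last by exists q2.
    by exists (q1 ^+ j); rewrite rmorphXn /= horner_exp q1z.
  exists (fun j => (s %% m)`_j); rewrite -(modp_eval s m0 mz) -eval_coef //.
  by rewrite -ltnS (leq_trans _ sm) // ltn_modp.
have [A uA] := functional_choice uE.
have [c [i0 ci0]] := span_dependent (ltnSn n.+1) uA.
rewrite big_ord_recl {1}/u unlift_none /=.
under eq_bigr do rewrite /u liftK /=.
pose w := \poly_(j < n.+1) c (lift ord0 (inord j)).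
have wE : (w ^ f).[t] = \sum_(j < n.+1) f (c (lift ord0 j)) * t ^+ j.
  rewrite (@eval_coef n.+1) ?size_poly //; apply: eq_bigr => j _.
  by rewrite coef_poly ltn_ord inord_val.
rewrite -wE => sum0.
have c00 : c ord0 != 0.
  apply: contra_notN tn => /eqP c0; exists w; split; last 1 first.
  - by move: sum0; rewrite c0 rmorph0 mul0r add0r /root => ->.
  - apply: contraNneq ci0 => w0; case: (unliftP ord0 i0) => [j ->|-> //]; last exact/eqP.
    have /(congr1 (fun s : {poly F} => s`_j)) := w0.
    by rewrite coef_poly ltn_ord inord_val coef0 => ->.
  - exact: size_poly.
exists (- (c ord0)^-1 *: w); rewrite linearZ /= hornerZ.
have fc0 : f (c ord0) != 0 by rewrite fmorph_eq0.
move/eqP: sum0; rewrite addrC addr_eq0 => /eqP ->.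
by rewrite rmorphN fmorphV mulNr mulrN opprK mulKf.
Qed.

Lemma separable_infinite_unbounded :
  (forall y, separable_over y) -> infinite_ext f -> unbounded_degree.
Proof.
move=> sep inf; apply: NNPP => no; apply: inf.
have [D hD] : exists D, forall y, degree_le D y.
  apply: NNPP => h; apply: no => D; apply: NNPP => h'; apply: h; exists D => y.
  by apply: NNPP => h''; apply: h'; exists y.
have [n [t ht]] := separable_in_simple hD.
apply: (@spanned_finite_degree n (fun i => t ^+ i)) => y.
by have [a] := ht y (sep y) 1; rewrite expr1 => ->; exists a; rewrite /lincomb big_mkord.
Qed.

Lemma infinite_ext_free : infinite_ext f -> forall n,
  exists y : nat -> E, free_over f y (index_iota 0 n).
Proof.
move=> inf; elim=> [|n [y fy]]; first by exists (fun=> 0) => c _ i; rewrite mem_index_iota.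
have [z hz] : exists z, forall c, z <> lincomb f y (index_iota 0 n) c.
  apply: NNPP => no; apply: inf; apply: (@spanned_finite_degree n y) => x.
  by apply: NNPP => h; apply: no; exists x => c e; apply: h; exists c.
exists (fun i => if i == n then z else y i) => c.
rewrite /lincomb big_nat_recr //= eqxx.
have -> : \sum_(0 <= i < n) f (c i) * (if i == n then z else y i) =
    lincomb f y (index_iota 0 n) c.
  by apply: eq_big_nat => i /andP[_ lt]; rewrite (ltn_eqF lt).
have [cn0|cn0] := eqVneq (c n) 0.
  rewrite cn0 rmorph0 mul0r addr0 => /fy h i.
  rewrite mem_index_iota /= ltnS leq_eqVlt => /predU1P[->//|lt].
  by apply: h; rewrite mem_index_iota.
move/eqP; rewrite addrC addr_eq0 => /eqP zE; case: (hz (fun i => - (c n)^-1 * c i)).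
rewrite lincombZ rmorphN fmorphV mulNr -mulrN -zE mulKf //.
by rewrite fmorph_eq0.
Qed.

End Degrees.

(** If neither alternative holds for [q], its gcd with its derivative is a proper factor, and [y] is
    a root of this factor or of the cofactor, both of smaller degree. *)
Lemma separable_or_deriv0 (F E : fieldType) (f : {rmorphism F -> E})
    (y : E) (q : {poly F}) : q != 0 -> root (map_poly f q) y ->
  exists r : {poly F}, [/\ r != 0, (size r <= size q)%N, root (map_poly f r) y &
    separable_poly r \/ r^`() = 0].
Proof.
have [n] := ubnP (size q); elim: n q => // n IH q sqn q0 qy.
have lift (r : {poly F}) : (size r < size q)%N -> r != 0 -> root (map_poly f r) y ->
    exists r' : {poly F}, [/\ r' != 0, (size r' <= size q)%N, root (map_poly f r') y &
      separable_poly r' \/ r'^`() = 0].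
  move=> rq r0 ry; have [|r' [r'0 r'r r'y sep]] := IH r _ r0 ry.
    exact: leq_trans rq _.
  by exists r'; split=> //; apply: leq_trans r'r (ltnW rq).
have [cop|ncop] := boolP (coprimep q q^`()).
  by exists q; split=> //; left; rewrite unlock.
have [/eqP dq0|dq0] := boolP (q^`() == 0); first by exists q; split=> //; right.
have /dvdpP[h qE] := dvdp_gcdl q q^`(); set g := gcdp _ _ in qE.
have g1 : (1 < size g)%N.
  by rewrite ltn_neqAle eq_sym ncop size_poly_gt0 gcdp_eq0 (negPf q0).
have g0 : g != 0 by rewrite -size_poly_gt0 ltnW.
have h0 : h != 0 by apply: contraNneq q0 => h0; rewrite qE h0 mul0r.
have gq : (size g < size q)%N.
  by apply: leq_ltn_trans (dvdp_leq dq0 (dvdp_gcdr _ _)) _; apply: lt_size_deriv.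
have hq : (size h < size q)%N.
  have -> : size q = (size h + size g).-1 by rewrite {1}qE size_mul.
  by rewrite -subn1 ltn_subRL addnC ltn_add2l.
have : root (map_poly f g) y || root (map_poly f h) y.
  by rewrite orbC -rootM -rmorphM -qE.
by case/orP; apply: lift.
Qed.

Lemma pchar0_separable (F E : fieldType) (f : {rmorphism F -> E}) :
  [pchar F] =i pred0 -> algebraic_ext f -> forall y, separable_over f y.
Proof.
move=> F0 alg y; have [q q0 qy] := alg y.
have [r [r0 _ ry [sep|dr0]]] := separable_or_deriv0 q0 qy; first by exists r.
have /pcharf0P natr0 := F0.
have r1 : (size r <= 1)%N.
  apply/leq_sizeP => -[//|k] _; have /polyP/(_ k) := dr0.
  by rewrite coef_deriv coef0 -mulr_natr => /eqP; rewrite mulf_eq0 natr0 orbF => /eqP.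
move: ry; rewrite (size1_polyC r1) map_polyC rootC fmorph_eq0.
by rewrite -polyC_eq0 -size1_polyC // (negPf r0).
Qed.

(** * Unbounded degrees in characteristic [p] *)

Section InseparableDegrees.

Variables (F E : fieldType) (f : {rmorphism F -> E}) (p : nat).
Hypothesis pF : p \in [pchar F].

Let p_pr : prime p := pcharf_prime pF.

(** A polynomial with zero derivative has the form [r(X^p)], and [r] vanishes at [y^p]. The degree
    drops from at most [D + 1] to at most [(D + 1) / p <= D]. *)
Lemma separable_power (D : nat) (y : E) (q : {poly F}) :
    q != 0 -> (size q <= D.+1)%N -> root (map_poly f q) y ->
  exists2 e, (e <= D)%N & separable_over f (y ^+ (p ^ e)).
Proof.
elim: D y q => [|D IH] y q q0 sq qy.
  move: qy; rewrite (size1_polyC sq) map_polyC rootC fmorph_eq0.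
  by rewrite -polyC_eq0 -size1_polyC // (negPf q0).
have {q0 qy} [r [r0 rq ry [sep|dr0]]] := separable_or_deriv0 q0 qy.
  by exists 0%N => //; rewrite expn0 expr1; exists r.
have {q sq rq r r0 ry dr0} [q [q0 sq qy dq0]] : exists q : {poly F},
    [/\ q != 0, (size q <= D.+2)%N, root (map_poly f q) y & q^`() = 0].
  by exists r; split=> //; apply: leq_trans sq.
have p_gt0 := prime_gt0 p_pr; have p_gt1 := prime_gt1 p_pr.
pose r := \poly_(i < D.+1) q`_(i * p).
have qE : q = r \Po 'X^p.
  apply/polyP => k; rewrite coef_comp_poly_Xn //; case: dvdnP => [[j ->]|ndv].
    rewrite mulnK // coef_poly; case: ltnP => // Dj.
    by rewrite nth_default // (leq_trans sq) //; nia.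
  have /polyP/(_ k.-1) := dq0; case: k ndv => [[]|k ndv]; first by exists 0%N.
  rewrite coef_deriv coef0 /= -mulr_natr => /eqP; rewrite mulf_eq0 => /orP[/eqP //|].
  by rewrite -(dvdn_pcharf pF) => /dvdnP.
have r0 : r != 0 by apply: contraNneq q0 => r0; rewrite qE r0 comp_poly0.
have ry : root (map_poly f r) (y ^+ p).
  by move: qy; rewrite qE map_comp_poly map_polyXn /root horner_comp hornerXn.
have [e eD sep] := IH _ r r0 (size_poly _ _) ry.
by exists e.+1 => //; rewrite expnS exprM.
Qed.

Fixpoint frobenius_iter (R : fieldType) (pR : p \in [pchar R]) (e : nat) :
    {rmorphism R -> R} :=
  if e is e'.+1 then (frobenius_iter pR e' \o pFrobenius_aut pR : {rmorphism R -> R})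
  else (idfun : {rmorphism R -> R}).

Lemma frobenius_iterE (R : fieldType) (pR : p \in [pchar R]) e x :
  frobenius_iter pR e x = x ^+ (p ^ e).
Proof.
elim: e x => [|e IH] x; first by [].
by rewrite /= pFrobenius_autE IH -exprM expnS.
Qed.

Hypothesis F_inf : forall q : {poly E}, q != 0 -> exists x : F, ~~ root q (f x).
Variables (n : nat) (b : nat -> F).
Hypothesis b_span : forall y,
  exists c, y = lincomb (pFrobenius_aut pF) b (index_iota 0 n) c.

(** Each coefficient is expanded over the [p]-th powers; its [p^e]-th power then involves
    [p^(e+1)]-th powers as coefficients. *)
Lemma frobenius_iter_spanned e : exists (T : finType) (B : T -> F), forall y,
  exists c : T -> F, y = \sum_t (c t) ^+ (p ^ e) * B t.
Proof.
elim: e => [|e [T [B hB]]].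
  exists unit, (fun=> 1) => y; exists (fun=> y).
  by rewrite (big_pred1 tt) => [|[]//]; rewrite expn0 expr1 mulr1.
exists (T * 'I_n)%type, (fun u : T * 'I_n => b (val u.2) ^+ (p ^ e) * B u.1) => y.
have [c ->] := hB y; have [d hd] := functional_choice (fun t => b_span (c t)).
exists (fun u : T * 'I_n => d u.1 (val u.2)).
rewrite -(pair_bigA _ (fun t (j : 'I_n) =>
  d t (val j) ^+ (p ^ e.+1) * (b (val j) ^+ (p ^ e) * B t))) /=.
apply: eq_bigr => t _; rewrite {1}hd /lincomb big_mkord.
rewrite -(frobenius_iterE pF) rmorph_sum mulr_suml; apply: eq_bigr => j _.
by rewrite rmorphM /= !frobenius_iterE pFrobenius_autE -exprM -expnS mulrA.
Qed.

(** If all degrees were at most [D], every [y^(p^D)] would lie in the span of powers of [t], a space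
    of dimension at most [m * #|T|] over [F^(p^D)]. One more element, all free over [F], gives
    dependent powers, and injectivity of Frobenius turns this into a relation over [F]. *)
Lemma finite_pdegree_infinite_unbounded : infinite_ext f -> unbounded_degree f.
Proof.
move=> inf; apply: NNPP => no.
have pE : p \in [pchar E] by rewrite (fmorph_pchar f).
have [D hD] : exists D, forall y, degree_le f D y.
  apply: NNPP => h; apply: no => D; apply: NNPP => h'; apply: h; exists D => y.
  by apply: NNPP => h''; apply: h'; exists y.
have [m [t ht]] := separable_in_simple F_inf hD.
have [T [B hB]] := frobenius_iter_spanned D.
have [y yfree] := infinite_ext_free inf (m * #|T|).+1.
pose sigma : {rmorphism F -> E} := frobenius_iter pE D \o f.
have sigmaE c : sigma c = f (c ^+ (p ^ D)) by rewrite rmorphXn /= frobenius_iterE.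
have span (i : 'I_(m * #|T|).+1) : exists A : 'I_m * T -> F,
    y i ^+ (p ^ D) = \sum_u sigma (A u) * (f (B u.2) * t ^+ u.1).
  have [q [q0 sq qy]] := hD (y i).
  have [e eD sep] := separable_power q0 sq qy.
  (* The exponent [e] varies with the element; a further power brings it to the common exponent
     [D]. *)
  have [a] := ht _ sep (p ^ (D - e))%N; rewrite -exprM -expnD subnKC // => ->.
  have [c hc] := functional_choice (fun k => hB (a k)).
  exists (fun u : 'I_m * T => c (val u.1) u.2).
  rewrite -(pair_bigA _ (fun (k : 'I_m) s => sigma (c (val k) s) * (f (B s) * t ^+ val k))) /=.
  apply: eq_bigr => k _; rewrite {1}hc rmorph_sum mulr_suml; apply: eq_bigr => s _.
  by rewrite rmorphM -sigmaE mulrA.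
have [A hA] := functional_choice span.
have [|c [i0 ci0] sum0] := span_dependent_fin _ hA.
  by rewrite card_prod card_ord.
have : lincomb f y (index_iota 0 (m * #|T|).+1) (fun i => c (inord i)) = 0.
  apply: (fmorph_inj (frobenius_iter pE D)); rewrite rmorph0 -[RHS]sum0.
  rewrite /lincomb big_mkord rmorph_sum; apply: eq_bigr => i _.
  by rewrite rmorphM /= [frobenius_iter _ _ (y i)]frobenius_iterE inord_val.
move/yfree/(_ (val i0)); rewrite mem_index_iota /= ltn_ord inord_val => /(_ isT) c0.
by rewrite c0 eqxx in ci0.
Qed.

End InseparableDegrees.

(** * Generic points *)

Section GenericFreeness.

Variables (F E : fieldType) (f : {rmorphism F -> E}).

(** [A] is a matrix of relations of maximal rank, so its row space is the space of
    all relations, which is the kernel of the cokernel of [A]. *)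
Lemma relation_matrix (N : nat) (w : 'I_N -> E) : exists B : 'M[F]_N,
  forall x : 'rV_N, x *m B = 0 <-> \sum_i f (x 0 i) * w i = 0.
Proof.
pose rel (x : 'rV[F]_N) := \sum_i f (x 0 i) * w i = 0.
have relM k (D : 'rV_k) (A : 'M_(k, N)) : (forall i, rel (row i A)) -> rel (D *m A).
  move=> hA; rewrite /rel.
  under eq_bigr do rewrite mxE rmorph_sum mulr_suml.
  rewrite exchange_big /=; apply: big1 => k' _.
  under eq_bigr do rewrite rmorphM -mulrA.
  rewrite -mulr_sumr; have := hA k'; rewrite /rel.
  by under eq_bigr do rewrite mxE; move=> ->; rewrite mulr0.
pose P r := exists2 A : 'M[F]_N, forall i, rel (row i A) & \rank A = r.
have [r [[A hA rA] rmax]] : exists r, P r /\ forall m, P m -> (m <= r)%N.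
  apply: (bounded_max (N := N)) => [|r [A _ <-]]; last exact: rank_leq_row.
  exists 0%N, 0; rewrite ?mxrank0 // => i; rewrite /rel big1 // => j _.
  by rewrite !mxE rmorph0 mul0r.
exists (cokermx A) => x; rewrite -/(rel x); split=> [/eqP|relx].
  by rewrite -submxE => /submxP[D ->]; apply: relM.
apply/eqP; rewrite -submxE.
have /rmax : P (\rank (A + x)%MS).
  exists (A + x)%MS => // i.
  have /sub_addsmxP[u ->] := row_sub i (A + x)%MS.
  have h1 : rel (u.1 *m A) by apply: relM.
  have h2 : rel (u.2 *m x) by apply: relM => k; rewrite row_id.
  rewrite /rel; under eq_bigr do rewrite mxE rmorphD mulrDl.
  by rewrite big_split /= h1 h2 addr0.
rewrite -rA => le; have [le' e] := mxrank_leqif_sup (addsmxSl A x).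
have sub : (A + x <= A)%MS by rewrite -e eqn_leq le' le.
exact: submx_trans (addsmxSr A x) sub.
Qed.

(** The relations over [F] among all coefficients of the [W a] are those among the rows of a matrix
    over [F]. Freeness at [f t] thus means full row rank of a matrix with entries polynomial in [t];
    it holds at 0, hence wherever a suitable determinant does not vanish. *)
Lemma generic_free (I : finType) (W : I -> {poly E}) :
    (forall c : I -> F, \sum_a f (c a) * (W a)`_0 = 0 -> forall a, c a = 0) ->
  exists2 g : {poly F}, g != 0 & forall t, ~~ root g t ->
    forall c : I -> F, \sum_a f (c a) * (W a).[f t] = 0 -> forall a, c a = 0.
Proof.
move=> W0; pose n := (\max_a size (W a)).+1.
have szW a : (size (W a) <= n)%N by apply: leqW; apply: (leq_bigmax a).
pose J := (I * 'I_n)%type; pose w (k : 'I_#|{: J}|) := (W (enum_val k).1)`_(enum_val k).2.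
have [B hB] := relation_matrix w.
pose N := #|{: J}|.
pose b (a : I) (j : 'I_n) (k : 'I_N) := B (enum_rank (a, j)) k.
have relB (x : J -> F) : (forall k, \sum_a \sum_(j < n) x (a, j) * b a j k = 0) <->
    \sum_a \sum_(j < n) f (x (a, j)) * (W a)`_j = 0.
  pose xr : 'rV[F]_N := \row_k x (enum_val k).
  have e1 k : (xr *m B) 0 k = \sum_a \sum_(j < n) x (a, j) * b a j k.
    rewrite mxE (reindex_onto enum_rank enum_val) /=; last by move=> u _; rewrite enum_valK.
    rewrite (eq_bigl xpredT) => [|u]; last by rewrite enum_rankK eqxx.
    rewrite pair_big /=; apply: eq_bigr => -[a j] _; rewrite mxE enum_rankK //.
  have e2 : \sum_k f (xr 0 k) * w k = \sum_a \sum_(j < n) f (x (a, j)) * (W a)`_j.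
    rewrite (reindex_onto enum_rank enum_val) /=; last by move=> u _; rewrite enum_valK.
    rewrite (eq_bigl xpredT) => [|u]; last by rewrite enum_rankK eqxx.
    rewrite pair_big /=; apply: eq_bigr => -[a j] _; rewrite /w mxE enum_rankK //.
  rewrite -e2 -hB; split=> [h|/rowP h k]; last by rewrite -e1 h mxE.
  by apply/rowP => k; rewrite e1 h mxE.
have relW (t : F) (c : I -> F) :
    (forall k : 'I_N, \sum_a c a * (\sum_(j < n) t ^+ j * b a j k) = 0) <->
    \sum_a f (c a) * (W a).[f t] = 0.
  have := relB (fun u => c u.1 * t ^+ val u.2) => /=.
  have -> : \sum_a \sum_(j < n) f (c a * t ^+ j) * (W a)`_j = \sum_a f (c a) * (W a).[f t].
    apply: eq_bigr => a _; rewrite (horner_coef_wide _ (szW a)) mulr_sumr.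
    by apply: eq_bigr => j _; rewrite rmorphM rmorphXn -mulrA [_ ^+ _ * _]mulrC.
  move=> <-; split=> h k; apply: etrans (h k); apply: eq_bigr => a _.
    by rewrite mulr_sumr; apply: eq_bigr => j _; rewrite mulrA.
  by rewrite mulr_sumr; apply: eq_bigr => j _; rewrite mulrA.
pose Mt (t : F) : 'M_(#|I|, N) := \matrix_(r, k) \sum_(j < n) t ^+ j * b (enum_val r) j k.
pose MX : 'M[{poly F}]_(#|I|, N) :=
  \matrix_(r, k) \sum_(j < n) (b (enum_val r) j k) *: 'X^j.
have ker t (x : 'rV_#|I|) : x *m Mt t = 0 <->
    \sum_a f (x 0 (enum_rank a)) * (W a).[f t] = 0.
  rewrite -relW; split=> [/rowP h k|h].
    have := h k; rewrite !mxE => hk; apply: etrans hk.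
    rewrite [RHS](reindex_onto enum_rank enum_val) /=; last first.
      by move=> u _; rewrite enum_valK.
    rewrite [RHS](eq_bigl xpredT) => [|u]; last by rewrite enum_rankK eqxx.
    by apply: eq_bigr => a _; rewrite mxE enum_rankK.
  apply/rowP => k; rewrite !mxE; apply: etrans (h k).
  rewrite [LHS](reindex_onto enum_rank enum_val) /=; last first.
    by move=> u _; rewrite enum_valK.
  rewrite [LHS](eq_bigl xpredT) => [|u]; last by rewrite enum_rankK eqxx.
  by apply: eq_bigr => a _; rewrite mxE enum_rankK.
have [G MG] : exists G, Mt 0 *m G = 1%:M.
  apply/row_freeP; rewrite -kermx_eq0; apply/eqP/row_matrixP => i; rewrite row0.
  apply/rowP => r; rewrite [RHS]mxE.
  set x := row i _; have : x *m Mt 0 = 0 by apply/sub_kermxP/row_sub.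
  move/ker; rewrite rmorph0 => h.
  rewrite -[r]enum_valK; apply: (W0 (fun a => x 0 (enum_rank a))); apply: etrans h.
  by apply: eq_bigr => a _; rewrite horner_coef0.
have evalM t : map_mx (horner_eval t) MX = Mt t.
  apply/matrixP => r k; rewrite !mxE /horner_eval horner_sum; apply: eq_bigr => j _.
  by rewrite hornerZ hornerXn mulrC.
(* [G] is a right inverse at 0, so [g] takes the value 1 there. *)
pose g := \det (MX *m map_mx polyC G).
have gE t : g.[t] = \det (Mt t *m G).
  have h := det_map_mx (horner_eval t) (MX *m map_mx polyC G).
  rewrite map_mxM evalM in h; apply: etrans (esym h) _; congr (\det (_ *m _)).
  by apply/matrixP => r k; rewrite !mxE; exact: hornerC.
exists g.
  apply/eqP => g0; have := gE 0; rewrite MG det1 g0 horner0 => /esym/eqP.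
  by rewrite oner_eq0.
move=> t; rewrite /root gE => dt c sum0 a.
pose x : 'rV[F]_#|I| := \row_r c (enum_val r).
have xM : x *m Mt t = 0.
  by apply/ker; apply: etrans sum0; apply: eq_bigr => a' _; rewrite mxE enum_rankK.
have U : Mt t *m G \in unitmx by rewrite unitmxE unitfE.
have : x = 0 by rewrite -(mulmxK U x) mulmxA xM !mul0mx.
by move/rowP/(_ (enum_rank a)); rewrite !mxE enum_rankK.
Qed.

End GenericFreeness.

Section Digits.

Local Open Scope nat_scope.

Definition digit_sum d m (a : 'I_m -> nat) := \sum_i a i * d ^ i.

Lemma digit_sum_recl d m (a : 'I_m.+1 -> nat) :
  digit_sum d a = a ord0 + d * digit_sum d (fun i => a (lift ord0 i)).
Proof.
rewrite /digit_sum big_ord_recl expn0 muln1 big_distrr; congr (_ + _).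
by apply: eq_bigr => i _; rewrite lift0 expnS mulnCA.
Qed.

Lemma digit_sum_lt d m (a : 'I_m -> nat) :
  (forall i, a i < d) -> digit_sum d a < d ^ m.
Proof.
elim: m a => [|m IH] a ha; first by rewrite /digit_sum big_ord0.
rewrite digit_sum_recl expnS.
have := IH _ (fun i => ha (lift ord0 i)); have := ha ord0.
move: (digit_sum _ _) (a ord0) (d ^ m) => s x y; nia.
Qed.

Lemma digit_sum_inj d m (a b : 'I_m -> nat) :
  (forall i, a i < d) -> (forall i, b i < d) ->
  digit_sum d a = digit_sum d b -> a =1 b.
Proof.
elim: m a b => [|m IH] a b ha hb; first by move=> _ [].
rewrite !digit_sum_recl => e.
have d0 : 0 < d by apply: leq_trans (ha ord0).
have e0 : a ord0 = b ord0.
  by have := congr1 (modn^~ d) e; rewrite ![_ + d * _]addnC ![d * _]mulnC !modnMDl !modn_small.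
have e1 : digit_sum d (fun i => a (lift ord0 i)) = digit_sum d (fun i => b (lift ord0 i)).
  by apply/eqP; rewrite -(eqn_pmul2l d0) -(eqn_add2l (a ord0)) e e0.
by move=> i; case: (unliftP ord0 i) => [j ->|-> //]; apply: (IH _ _ _ _ e1).
Qed.

End Digits.

Section GenericPoints.

Variables (F E : fieldType) (f : {rmorphism F -> E}).

Lemma bmultinom_lt m d (al : 'X_{1..m < d}) i : (al i < d)%N.
Proof.
apply: leq_ltn_trans (bmdeg al); rewrite mdegE (bigD1 i) //=; exact: leq_addr.
Qed.

(** Kronecker substitution: the monomial [al] becomes the power of [t] whose exponent has the base
    [d] digits [al]. Distinct monomials give distinct exponents below [d^m]. *)
Lemma kronecker_free (t : E) m d : ~ degree_le f (d ^ m) t ->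
  forall c : 'X_{1..m < d} -> F,
    \sum_al f (c al) * mmap1 (fun i : 'I_m => t ^+ (d ^ i)) al = 0 ->
  forall al, c al = 0.
Proof.
move=> deg c sum0 al; pose e (b : 'X_{1..m < d}) := digit_sum d (fun i => b i).
pose p := \sum_b c b *: 'X^(e b).
have pt : (map_poly f p).[t] = 0.
  rewrite -[RHS]sum0 rmorph_sum horner_sum; apply: eq_bigr => b _.
  rewrite /= linearZ /= map_polyXn hornerZ hornerXn; congr (_ * _).
  rewrite /mmap1 /e /digit_sum expr_sum; apply: eq_bigr => i _.
  by rewrite mulnC exprM.
have p0 : p = 0.
  apply/eqP/negPn/negP => p0; apply: deg; exists p; split=> //; last exact/eqP.
  apply: leqW; apply: (leq_trans (size_sum _ _ _)); apply/bigmax_leqP => b _.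
  apply: leq_trans (size_scale_leq _ _) _; rewrite size_polyXn.
  by apply: digit_sum_lt => i; apply: bmultinom_lt.
have := congr1 (fun q : {poly F} => q`_(e al)) p0.
rewrite coef0 coef_sum (bigD1 al) //= coefZ coefXn eqxx mulr1 big1 ?addr0 // => b ne.
rewrite coefZ coefXn; case: eqP => [eq|]; last by rewrite mulr0.
case/eqP: ne; apply/eqP; rewrite bmeqP; apply/eqP/mnmP => i.
by apply: (digit_sum_inj _ _ (esym eq)) => j; apply: bmultinom_lt.
Qed.

(** In terms of [1/c] the perturbed point is proportional to [y + s/c], whose
    monomials specialize at [1/c = 0] to those of [y]. *)
Lemma generic_perturbation m d (s y : 'I_m -> E) :
    (forall c : 'X_{1..m < d} -> F,
      \sum_al f (c al) * mmap1 y al = 0 -> forall al, c al = 0) ->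
  exists2 g : {poly F}, g != 0 & forall t, t != 0 -> ~~ root g t^-1 ->
    forall c : 'X_{1..m < d} -> F,
      \sum_al f (c al) * mmap1 (fun i => s i + f t * y i) al = 0 ->
    forall al, c al = 0.
Proof.
move=> yfree.
pose W (al : 'X_{1..m < d}) := \prod_(i < m) (s i *: 'X + (y i)%:P) ^+ al i.
have WE al x : (W al).[x] = mmap1 (fun i => s i * x + y i) al.
  rewrite /W horner_prod; apply: eq_bigr => i _.
  by rewrite horner_exp hornerD hornerZ hornerX hornerC.
have [c|g g0 hg] := @generic_free _ _ f _ W.
  move=> sum0; apply: yfree; apply: etrans sum0; apply: eq_bigr => al _.
  rewrite -horner_coef0 WE; congr (_ * _); apply: mmap1_eq => i.
  by rewrite mulr0 add0r.
exists g => // t t0 gt c sum0 al.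
have ft0 : f t != 0 by rewrite fmorph_eq0.
(* By homogeneity, passing from [s + t y] to [y + s / t] rescales the coefficient at [al] by
   [t ^+ mdeg al]. *)
suff : c al * t ^+ mdeg al = 0.
  by move/eqP; rewrite mulf_eq0 expf_eq0 (negPf t0) andbF orbF => /eqP.
apply: (hg _ gt (fun al => c al * t ^+ mdeg al)); apply: etrans sum0.
apply: eq_bigr => b _; rewrite rmorphM -mulrA; congr (_ * _).
rewrite WE rmorphXn /= mdegE expr_sum /mmap1 -big_split /=; apply: eq_bigr => i _.
by rewrite -exprMn; congr (_ ^+ _); rewrite fmorphV mulrDr mulrCA mulfV // mulr1 addrC.
Qed.

End GenericPoints.

(** * The Liouville construction *)

Section Nontrivial.

Variable K : valuedField.
Hypothesis K_nontriv : nontrivially_valued K.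

Lemma exists_small : exists2 a : K, a != 0 & nlt a 1.
Proof.
have [x x0 vx] := K_nontriv; case: (ltgtP (valuation x) 0) => h.
- exists x^-1; rewrite ?invr_eq0 // nltE ?invr_eq0 ?oner_neq0 // valuation1.
  by rewrite valuationV // -(ozmod_ltD2l (valuation x)) addr0 subrr.
- by exists x; rewrite // nltE ?oner_neq0 // valuation1.
- by rewrite h eqxx in vx.
Qed.

Lemma exprI_small (a : K) : a != 0 -> nlt a 1 -> injective (fun n => a ^+ n).
Proof.
move=> a0 a1; suff lt j k : (j < k)%N -> a ^+ j <> a ^+ k.
  by move=> j k; case: (ltngtP j k) => // /lt h e; case: h.
move=> jk e; have := nltX (k - j).-1 a1; rewrite prednK ?subn_gt0 // expr1n.
by rewrite expfB // -e divff ?expf_neq0 // nltxx.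
Qed.

Lemma not_all_roots (E : fieldType) (u : nat -> E) (q : {poly E}) :
  injective u -> q != 0 -> exists n, ~~ root q (u n).
Proof.
move=> u_inj q0; apply: NNPP => no.
have := @max_poly_roots _ q (mkseq u (size q)) q0.
rewrite size_mkseq ltnn => h; suff : false by [].
apply: h; last by rewrite mkseq_uniq.
by apply/allP => x /mapP[n _ ->]; apply/negPn/negP => h; apply: no; exists n.
Qed.

(** A nontrivially valued field is infinite: the powers of a nonzero element of norm below 1 are
    distinct. *)
Lemma valued_nonroot (E : fieldType) (f : {rmorphism K -> E}) (q : {poly E}) :
  q != 0 -> exists x, ~~ root q (f x).
Proof.
have [a a0 a1] := exists_small => q0.
have [|n hn] := @not_all_roots _ (fun n => f (a ^+ n)) q _ q0; last by exists (a ^+ n).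
by move=> j k /fmorph_inj /exprI_small; apply.
Qed.

End Nontrivial.

Section Liouville.

Variables (K L M : valuedField) (i : valuedExt K L) (j : valuedExt L M).
Hypothesis K_nontriv : nontrivially_valued K.
Hypothesis K_sc : spherically_complete K.
Hypothesis M_sc : spherically_complete M.
Hypothesis L_alg : algebraic_ext (ext_embed i).
Hypothesis L_deg : unbounded_degree (ext_embed i).
Variable m : nat.
Local Notation f := (ext_embed i).
Local Notation g := (ext_embed j).

(** The generic point formed by powers of [t] is scaled by [e / C * a ^+ n] and added to [s]. As [C]
    bounds these powers, the shift is at most [e]; the roots of [q] exclude only finitely many
    [n]. *)
Lemma generic_dense d (s : 'I_m -> L) (e : K) : e != 0 ->
  exists s' : 'I_m -> L, (forall k, nle (s' k - s k) (f e)) /\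
    forall c : 'X_{1..m < d} -> K,
      \sum_al f (c al) * mmap1 s' al = 0 -> forall al, c al = 0.
Proof.
move=> e0; have [t ht] := L_deg (d ^ m)%N; pose y (k : 'I_m) := t ^+ (d ^ k).
have [q q0 hq] := generic_perturbation s (kronecker_free ht).
have [C C0 hC] := bounded_seq (algebraic_bounded L_alg) [seq y k | k : 'I_m].
have [a a0 a1] := exists_small K_nontriv.
pose u n := (e / C * a ^+ n)^-1.
have eC0 : e / C != 0 by rewrite mulf_neq0 ?invr_eq0.
have [n hn] : exists n, ~~ root q (u n).
  apply: not_all_roots q0 => k l /invr_inj /(mulfI eC0).
  exact: exprI_small a0 a1 _ _.
have un0 : e / C * a ^+ n != 0 by rewrite mulf_neq0 ?expf_neq0.
exists (fun k => s k + f (e / C * a ^+ n) * y k); split; last exact: hq.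
move=> k; rewrite addrAC subrr add0r.
apply: (@nle_trans _ (f (e / C * a ^+ n) * f C)).
  by apply: nleM (nle_refl _) _; apply: hC; apply: image_f.
rewrite -rmorphM nle_ext mulrAC divfK // -[X in nle _ X]mulr1.
by apply: nleM (nle_refl _) _; rewrite -(expr1n _ n) nleX // nltW.
Qed.

(** The last field reads [|P(s)| >= |k||P|] for the Gauss norm [|P|]; all later
    points of the sequence will lie within [|e| < |k|] of [s]. *)
Record stage (n : nat) (s : 'I_m -> L) (k e : K) : Prop := Stage {
  stage_int : forall l, nle (s l) 1;
  stage_e0 : e != 0;
  stage_e1 : nle e 1;
  stage_ek : nlt e k;
  stage_bound : forall (c : 'X_{1..m < n} -> K) al,
    nle (f (k * c al)) (\sum_be f (c be) * mmap1 s be)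
}.

Lemma stage0 : exists s k e, stage 0 s k e.
Proof.
have [a a0 a1] := exists_small K_nontriv.
(* No monomial has degree below 0, so the bound is vacuous. *)
exists (fun=> 0), 1, a; split=> //; last by move=> c [al].
- by move=> l; apply: nle0.
- exact: nltW.
Qed.

(** At a generic [s'] near [s] the monomials of degree at most [n] are free over [K], and
    equivalence of norms supplies a constant [C]. Then [k'] is [C^-1], and [e'] is chosen below both
    [e] and [C^-1]. *)
Lemma stageS n s k e : stage n s k e ->
  exists s' k' e', [/\ stage n.+1 s' k' e', forall l, nle (s' l - s l) (f e)
    & nle e' e].
Proof.
case=> s1 e0 e1 ek bd; have [s' [ss' free]] := generic_dense n.+1 s e0.
have [|C C0 hC] := norm_equivalence (algebraic_bounded L_alg) K_sc
  (index_enum_uniq 'X_{1..m < n.+1})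
  (b := fun al : 'X_{1..m < n.+1} => mmap1 s' al).
  by move=> c /free h al _; apply: h.
have [a a0 a1] := exists_small K_nontriv.
have [e' [e'0 e'e e'C]] : exists e', [/\ e' != 0, nle e' e & nlt e' C^-1].
  have lt b : b != 0 -> nlt (a * b) b.
    by move=> b0; rewrite mulrC -[X in nlt _ X]mulr1 nltM2l.
  case/orP: (nle_total e C^-1) => h.
    by exists (a * e); split; [exact: mulf_neq0 | exact/nltW/lt | exact: nlt_le_trans (lt _ e0) h].
  have C'0 : C^-1 != 0 by rewrite invr_eq0.
  exists (a * C^-1); split; [exact: mulf_neq0 | | exact: lt].
  exact/nltW/(nlt_le_trans (lt _ C'0) h).
exists s', C^-1, e'; split=> //; split=> //.
- move=> l; rewrite -(subrK (s l) (s' l)) nleD //; apply: nle_trans (ss' l) _.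
  by rewrite -(rmorph1 f) nle_ext.
- exact: nle_trans e1.
move=> c al; have fC0 : f C != 0 by rewrite fmorph_eq0.
rewrite -(nleM2l _ _ fC0) -rmorphM mulVKf //.
by apply: hC; rewrite mem_index_enum.
Qed.

(** Monomials are 1-Lipschitz on the unit ball: [a b - c d = a (b - d) + (a - c) d] passes the bound
    from factors to products. *)
Lemma nle_mmap1B (x y : 'I_m -> M) (e : M) (al : 'X_{1..m}) :
    (forall k, nle (x k) 1) -> (forall k, nle (y k) 1) ->
    (forall k, nle (x k - y k) e) ->
  nle (mmap1 x al - mmap1 y al) e.
Proof.
move=> x1 y1 xy.
have prodB (a b c d : M) : nle a 1 -> nle d 1 -> nle (a - c) e -> nle (b - d) e ->
    nle (a * b - c * d) e.
  move=> a1 d1 ac bd; have -> : a * b - c * d = a * (b - d) + (a - c) * d.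
    by rewrite mulrBr mulrBl addrA subrK.
  rewrite nleD //; first by rewrite -[e]mul1r nleM.
  by rewrite -[e]mulr1 nleM.
have pow n k : [/\ nle (x k ^+ n) 1, nle (y k ^+ n) 1 & nle (x k ^+ n - y k ^+ n) e].
  split; try by rewrite -(expr1n _ n) nleX.
  elim: n => [|n IH]; first by rewrite subrr nle0.
  by rewrite !exprS prodB // -(expr1n _ n) nleX.
rewrite /mmap1; suff [] : [/\ nle (\prod_(k < m) x k ^+ al k) 1,
  nle (\prod_(k < m) y k ^+ al k) 1 & 
  nle (\prod_(k < m) x k ^+ al k - \prod_(k < m) y k ^+ al k) e] by [].
elim/big_rec2: _ => [|k a b _ [b1 a1 ab]]; first by rewrite subrr nle0 nle_refl.
have [xk yk xyk] := pow (al k) k.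
by split; [rewrite -[1]mulr1 nleM | rewrite -[1]mulr1 nleM | apply: prodB].
Qed.

(** Let [b] be a pseudo-limit of the points [s_n]. If [P(b) = 0] with [P] nonzero of degree below
    [n], then [|P(s_n)| = |P(s_n) - P(b)| <= |e_n||P| < |k_n||P| <= |P(s_n)|], a contradiction. *)
Lemma algebraically_independent_base : exists b : 'I_m -> M,
  forall q : {mpoly K[m]}, mmap (g \o f) b q = 0 -> q = 0.
Proof.
(* Making the stage hypothesis a premise of [step] lets plain choice produce a total successor
   function. *)
pose step (x : nat * (('I_m -> L) * K * K)) (y : ('I_m -> L) * K * K) :=
  stage x.1 x.2.1.1 x.2.1.2 x.2.2 ->
  [/\ stage x.1.+1 y.1.1 y.1.2 y.2, forall l, nle (y.1.1 l - x.2.1.1 l) (f x.2.2)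
    & nle y.2 x.2.2].
have [nx hnx] : exists nx, forall x, step x (nx x).
  apply: functional_choice => -[n [[s k] e]].
  case: (classic (stage n s k e)) => [/stageS[s' [k' [e' h]]]|nst].
    by exists (s', k', e').
  by exists (s, k, e) => /nst.
have [s0 [k0 [e0 st0]]] := stage0.
pose st := fix st n := if n is n'.+1 then nx (n', st n') else (s0, k0, e0).
pose s n := (st n).1.1; pose k n := (st n).1.2; pose e n := (st n).2.
have stP n : stage n (s n) (k n) (e n).
  elim: n => [|n IH]; first exact: st0.
  by have [h _ _] := hnx (n, st n) IH; exact: h.
have sS n l : nle (s n.+1 l - s n l) (f (e n)) by have [_ h _] := hnx (n, st n) (stP n); exact: h.
have eS n : nle (e n.+1) (e n) by have [_ _ h] := hnx (n, st n) (stP n); exact: h.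
have e_le n n' : (n <= n')%N -> nle (e n') (e n).
  move/subnK <-; elim: (n' - n)%N => [|r IH]; first exact: nle_refl.
  by rewrite addSn (nle_trans (eS _)).
have s_le n n' l : (n <= n')%N -> nle (s n' l - s n l) (f (e n)).
  move/subnK <-; elim: (n' - n)%N => [|r IH]; first by rewrite subrr nle0.
  rewrite addSn -(subrKA (s (r + n)%N l)) nleD // (nle_trans (sS _ _)) //.
  by rewrite nle_ext e_le // leq_addl.
pose B l n (x : M) := nle (x - g (s n l)) (g (f (e n))).
have lim l : exists x, forall n, B l n x.
  have sub n n' : (n <= n')%N -> forall x, B l n' x -> B l n x.
    move=> nn' x h; rewrite /B -(subrKA (g (s n' l))) nleD //.
      by apply: nle_trans h _; rewrite !nle_ext e_le.
    by rewrite -rmorphB nle_ext s_le.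
  apply: M_sc.
  - by move=> n; exists (g (s n l)); rewrite /B subrr nle0.
  - by move=> n n'; case/orP: (leq_total n n') => /sub; [right | left].
  move=> n x y z Bx By zx; rewrite /B -(subrKA x) nleD //.
  apply: nle_trans zx _; rewrite -(subrKA (g (s n l))) nleD //.
  by rewrite nleBC.
have [b hb] := functional_choice lim.
have s1 n l : nle (g (s n l)) 1.
  by rewrite -(rmorph1 g) nle_ext; apply: (stage_int (stP n)).
have b1 l : nle (b l) 1.
  rewrite -(subrK (g (s 0%N l)) (b l)) nleD // (nle_trans (hb l 0%N)) //.
  by rewrite -(rmorph1 g) nle_ext -(rmorph1 f) nle_ext; apply: (stage_e1 (stP 0%N)).
exists b => q qb0; apply/eqP/negPn/negP => q0.
pose n := msize q; pose c (al : 'X_{1..m < n}) := q@_al.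
have [al0 c0] : exists al, c al != 0.
  apply: NNPP => no; case/eqP: q0; rewrite (mpolywE (leqnn n)) big1 // => al _.
  have [->|cal] := eqVneq q@_al 0; first by rewrite scale0r.
  by case: no; exists al.
(* A coefficient of largest norm, which is the Gauss norm of [q]. *)
have [al1 c1] : exists al1, forall al, nle (c al) (c al1).
  have [al _ hal] : exists2 al, al \in index_enum 'X_{1..m < n} &
      forall be, be \in index_enum 'X_{1..m < n} -> nle (c be) (c al).
    have : index_enum 'X_{1..m < n} != [::].
      by apply: contraTneq (mem_index_enum al0) => ->.
    elim: (index_enum _) => // al r IH _.
    have [->|r0] := eqVneq r [::].
      by exists al; rewrite ?mem_head // => be; rewrite inE => /eqP ->; apply: nle_refl.
    have [be rbe hbe] := IH r0; case/orP: (nle_total (c al) (c be)) => h.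
      exists be; first by rewrite inE rbe orbT.
      by move=> ga; rewrite inE => /predU1P[->|/hbe].
    exists al; first exact: mem_head.
    move=> ga; rewrite inE => /predU1P[->|/hbe h']; first exact: nle_refl.
    exact: nle_trans h' h.
  by exists al => be; apply: hal; apply: mem_index_enum.
have cal1 : c al1 != 0 by apply: contraNneq c0 => e1; rewrite -nlex0 -e1 c1.
pose D := g (f (c al1)).
have D0 : D != 0 by rewrite !fmorph_eq0.
have h1 : nle (D * g (f (k n))) (g (\sum_be f (c be) * mmap1 (s n) be)).
  by rewrite -!rmorphM nle_ext mulrC; apply: (stage_bound (stP n)).
have h2 : nle (g (\sum_be f (c be) * mmap1 (s n) be)) (D * g (f (e n))).
  rewrite -nleN -[- _]add0r -[X in nle (X - _)]qb0 (mmapE n) // rmorph_sum -sumrB.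
  apply: nle_sum => be _; rewrite rmorphM -mulrBr; apply: nleM.
    by rewrite !nle_ext; exact: (c1 be).
  rewrite /mmap1 rmorph_prod; under eq_bigr do rewrite rmorphXn.
  apply: nle_mmap1B => // l; exact: hb.
have := nle_trans h1 h2; rewrite nleM2l // !nle_ext.
by apply/negP; apply: (stage_ek (stP n)).
Qed.

End Liouville.

(** * Passage to the algebraic extension *)

Section AlgebraicBase.

Variables (K L M : fieldType) (f : {rmorphism K -> L}) (g : {rmorphism L -> M}).
Hypothesis L_alg : algebraic_ext f.

(** The coefficients are algebraic, hence integral, and integral elements are closed under sums and
    products. *)
Lemma mpoly_integral n (P : {mpoly L[n]}) :
  integralOver (map_mpoly f : {mpoly K[n]} -> {mpoly L[n]}) P.
Proof.
rewrite (mpolyE P); elim/big_ind: _ => [|x y|al _].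
- exact: integral0.
- exact: integral_add.
rewrite -mul_mpolyC -[X in _ * X](map_mpolyX f); apply: integral_mul; last exact: integral_id.
have /integral_algebraic[q qm qx] := L_alg P@_al.
exists (map_poly (@mpolyC n K) q); first by rewrite map_monic.
have -> : map_poly (map_mpoly f) (map_poly (@mpolyC n K) q) =
    map_poly (@mpolyC n L) (map_poly f q).
  by apply/polyP => k; rewrite !coef_map /= map_mpolyC.
by move: qx; rewrite /root horner_map => /eqP -> /=; rewrite mpolyC0.
Qed.

Lemma mmap_map_mpoly n (b : 'I_n -> M) (q : {mpoly K[n]}) :
  mmap g b (map_mpoly f q) = mmap (g \o f) b q.
Proof.
rewrite (map_mpolyE f (leqnn (msize q))) [RHS](mmapE (msize q)) // rmorph_sum.
by apply: eq_bigr => al _; rewrite /= mmapZ mmapX.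
Qed.

(** A nonzero [P] over [L] is integral over the polynomials with coefficients in
    [K]; the constant coefficient of a shortest relation is a nonzero multiple
    of [P] with coefficients in [K]. *)
Lemma algebraically_independent_algebraic n (b : 'I_n -> M) :
    (forall q : {mpoly K[n]}, mmap (g \o f) b q = 0 -> q = 0) ->
  algebraically_independent g b.
Proof.
move=> ind P Pb; apply/eqP/negPn/negP => P0.
have [q qm qP] := mpoly_integral P; have {qm} := monic_neq0 qm.
elim/poly_ind: q qP => [|q c IH]; first by rewrite eqxx.
rewrite rmorphD rmorphM /= map_polyX map_polyC /root hornerMXaddC => qP q0.
have c0 : c = 0.
  apply: ind; rewrite -mmap_map_mpoly.
  move: qP; rewrite addrC addr_eq0 => /eqP ->.
  by rewrite rmorphN rmorphM /= Pb mulr0 oppr0.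
apply: IH.
  by move: qP; rewrite c0 raddf0 addr0 mulf_eq0 (negPf P0) orbF.
by apply: contraNneq q0 => ->; rewrite c0 mul0r addr0.
Qed.

End AlgebraicBase.

(** * Unbounded degrees under the two hypotheses, and conclusion *)

Lemma unbounded_degree_sub (K E L : fieldType) (g : {rmorphism K -> E})
    (h : {rmorphism E -> L}) (f : {rmorphism K -> L}) :
  (forall x, h (g x) = f x) -> unbounded_degree g -> unbounded_degree f.
Proof.
move=> hg deg D; have [y ny] := deg D; exists (h y) => -[p [p0 sp py]]; apply: ny.
exists p; split=> //; move: py; rewrite /root -(fmorph_eq0 h) -horner_map -map_poly_comp.
by rewrite (eq_map_poly (hg : _ \o _ =1 _)).
Qed.

Theorem theorem1p2 (K L : valuedField) (i : valuedExt K L) (p : nat)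
  (hKnontriv : nontrivially_valued K)
  (hKmax : maximal_valued_field K)
  (hLalg : algebraic_ext (ext_embed i))
  (hLinf : infinite_ext (ext_embed i))
  (hp : characteristic_exponent (residue_field K) p)
  (hor : has_infinite_separable_subext (ext_embed i) \/
         (finite_index_multiples (value_group K) p /\
          finite_p_degree (residue_field K) p)) :
  forall (M : valuedField) (j : valuedExt L M),
    maximal_immediate_ext j -> infinite_trdeg (ext_embed j).
Proof.
move=> M j [_ Mmax] n.
have Ksc := maximal_spherically_complete hKmax.
have nonroot (E : fieldType) (g : {rmorphism K -> E}) := valued_nonroot hKnontriv g.
have deg : unbounded_degree (ext_embed i).
  case: hor => [[E [g [h [hg sep inf]]]]|[fi fd]].
    apply: (unbounded_degree_sub hg); apply: (separable_infinite_unbounded (nonroot _ g)) inf.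
    by move=> y; have [q [_ qy sq]] := sep y; exists q.
  have [pK|npK] := boolP (p \in [pchar K]).
    have [k [b hb]] := frobenius_spanned pK Ksc fi fd.
    exact: (finite_pdegree_infinite_unbounded (nonroot _ _) hb).
  apply: (separable_infinite_unbounded (nonroot _ _)) hLinf.
  (* A positive characteristic [q] of [K] is also that of the residue field, hence equals [p], which
     this branch excludes. So [K] has characteristic 0 and algebraic elements are separable. *)
  apply: pchar0_separable hLalg => q; apply/negP => qK.
  have qk := residue_pchar qK.
  case: hp => [pk|[k0 _]]; last by rewrite k0 in qk.
  rewrite (pcharf_eq pk) inE in qk.
  by rewrite -(eqP qk) qK in npK.
have [b hb] := algebraically_independent_base j hKnontriv Ksc
  (maximal_spherically_complete Mmax) hLalg deg n.
exists b; exact: (algebraically_independent_algebraic hLalg hb).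
Qed.
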